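(* Let $n\ge 1$, $1<p<\infty$ and $\alpha\ge 0$. There exists a constant $C=C(n,p,\alpha)>0$ depending only on $n$, $p$ and $\alpha$ such that for every $0<s<1$ and every $f\in C_c^\infty(\mathbb{H}^n_+)$, $$\frac{C}{\left(s+\frac{\alpha}{p}\right)(1-s)}\int_{\mathbb{H}^n_+}\frac{|f(\xi)|^p}{x_1^{sp+\alpha}}\,d\xi\le \int_{\mathbb{H}^n}\int_{\mathbb{H}^n}\frac{|f(\xi)-f(\xi')|^p}{d(\xi^{-1}\circ\xi')^{Q+sp}\,|z-z'|^{\alpha}}\,d\xi'\,d\xi,$$ where $\xi=(z,t)=(x_1,\ldots,x_n,y_1,\ldots,y_n,t)$ and $\xi'=(z',t')$.
   Context: The Heisenberg group $\mathbb{H}^n$ ($n\ge1$) is $\mathbb{R}^n\times\mathbb{R}^n\times\mathbb{R}$ with points $\xi=(z,t)=(x,y,t)$, $z=(x,y)$, and group law $\xi\circ\xi'=(x+x',\,y+y',\,t+t'+2\langle y,x'\rangle-2\langle x,y'\rangle)$; the inverse is $\xi^{-1}=-\xi$. The homogeneous norm is $d(\xi)=(|z|^4+t^2)^{1/4}$, and $Q=2n+2$ is the homogeneous dimension. $d\xi$ is Lebesgue measure on $\mathbb{R}^{2n+1}$. The half-space is $\mathbb{H}^n_+=\{\xi=(x,y,t)\in\mathbb{H}^n: x_1>0\}$. Functions in $C_c^\infty(\mathbb{H}^n_+)$ are extended by zero to $\mathbb{H}^n$. The right-hand side may be $+\infty$, in which case the inequality holds trivially. *)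

(* Defs.v *)
From HB Require Import structures.
From mathcomp Require Import all_boot all_order all_algebra.
From mathcomp Require Import all_classical all_reals all_analysis.

Set Implicit Arguments.
Unset Strict Implicit.
Unset Printing Implicit Defensive.

Import Order.TTheory GRing.Theory Num.Theory.
Import numFieldNormedType.Exports.

Local Open Scope classical_set_scope.
Local Open Scope ring_scope.

Definition measure_rV_display : measure_display.
Proof. exact: default_measure_display. Qed.

(* The sigma-algebra on R^n generated by the n coordinates (the construction
   used by the library for n.-tuple R); it is the Borel sigma-algebra. *)
Section measurable_rV.
Context {R : realType} (n : nat).

Let coors : 'I_n -> 'rV[R]_n -> measurableTypeR R := fun i v => v ord0 i.

Let rV_set0 : g_sigma_preimage coors set0.
Proof. exact: sigma_algebra0. Qed.

Let rV_setC A : g_sigma_preimage coors A -> g_sigma_preimage coors (~` A).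
Proof. exact: sigma_algebraC. Qed.

Let rV_bigcup (F : _^nat) : (forall i, g_sigma_preimage coors (F i)) ->
  g_sigma_preimage coors (\bigcup_i (F i)).
Proof. exact: sigma_algebra_bigcup. Qed.

HB.instance Definition _ := @isMeasurable.Build measure_rV_display
  'rV[R]_n (g_sigma_preimage coors) rV_set0 rV_setC rV_bigcup.

End measurable_rV.

Lemma measurable_rV_coord (R : realType) n (i : 'I_n) :
  measurable_fun [set: 'rV[R]_n] (fun v => v ord0 i : measurableTypeR R).
Proof.
move=> _ Y mY; rewrite setTI; apply: sub_sigma_algebra => /=.
rewrite -bigcup_seq/=; exists i => /=; first by rewrite mem_index_enum.
by exists Y => //; rewrite setTI.
Qed.

Lemma measurable_fun_rVP d (T : measurableType d) (R : realType) n
    (f : T -> 'rV[R]_n) :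
  measurable_fun [set: T] f <->
  forall i, measurable_fun [set: T] (fun x => f x ord0 i : measurableTypeR R).
Proof.
split=> [mf i|mf].
  by apply: (measurableT_comp (measurable_rV_coord i) mf).
move=> _ A mA; rewrite setTI.
have sub : g_sigma_preimage
    (fun (i : 'I_n) (v : 'rV[R]_n) => v ord0 i : measurableTypeR R) `<=`
    [set B | measurable (f @^-1` B)].
  apply: smallest_sub.
    split.
    - by rewrite /= preimage_set0.
    - move=> B /= mB; rewrite setTD preimage_setC; exact: measurableC.
    - move=> F /= mF; rewrite preimage_bigcup; exact: bigcupT_measurable.
  rewrite -bigcup_seq => _ [i _ [B mB <-]] /=; rewrite setTI.
  by have := mf i measurableT B mB; rewrite setTI.
exact: sub.
Qed.

Definition rV_cons (R : realType) n (u : measurableTypeR R * 'rV[R]_n) :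
    'rV[R]_n.+1 :=
  row_mx (const_mx u.1 : 'rV[R]_1) u.2.

Definition rV_uncons (R : realType) n (v : 'rV[R]_n.+1) :
    measurableTypeR R * 'rV[R]_n :=
  (v ord0 ord0, \row_i v ord0 (lift ord0 i)).

Lemma rV_consK (R : realType) n : cancel (@rV_cons R n) (@rV_uncons R n).
Proof.
move=> [a u]; rewrite /rV_uncons /rV_cons/=; congr pair.
  by rewrite mxE; case: splitP => // j _; rewrite mxE.
apply/rowP => i; rewrite mxE -(row_mxEr (const_mx a : 'rV_1) u).
by congr (row_mx _ _ _ _); apply/val_inj.
Qed.

Lemma rV_unconsK (R : realType) n : cancel (@rV_uncons R n) (@rV_cons R n).
Proof.
move=> v; apply/rowP => i; rewrite mxE; case: splitP => j /= ij.
  by rewrite mxE; congr (v _ _); apply/val_inj; rewrite /= ij ord1.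
by rewrite mxE; congr (v _ _); apply/val_inj.
Qed.

Lemma measurable_rV_cons (R : realType) n : measurable_fun setT (@rV_cons R n).
Proof.
apply/measurable_fun_rVP => i.
case: (split_ordP (i : 'I_(1 + n))) => j ->.
  rewrite [X in measurable_fun _ X](_ : _ = fst); first exact: measurable_fst.
  by apply/funext => u; rewrite (row_mxEl (const_mx u.1 : 'rV[R]_1) u.2) mxE.
rewrite [X in measurable_fun _ X](_ : _ =
  (fun v : 'rV[R]_n => v ord0 j : measurableTypeR R) \o snd).
  exact: (measurableT_comp (measurable_rV_coord j) measurable_snd).
by apply/funext => u; exact: (row_mxEr (const_mx u.1 : 'rV[R]_1) u.2).
Qed.

Lemma measurable_rV_uncons (R : realType) n :
  measurable_fun setT (@rV_uncons R n).
Proof.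
apply: measurable_fun_pair; first exact: measurable_rV_coord.
apply/measurable_fun_rVP => i.
rewrite [X in measurable_fun _ X](_ : _ =
  (fun v : 'rV[R]_n.+1 => v ord0 (lift ord0 i) : measurableTypeR R)).
  exact: measurable_rV_coord.
by apply/funext => v; rewrite mxE.
Qed.

(* In the library, \x carries a canonical sigma-finite structure only when both
   factors are finite measures. *)
Lemma sigma_finite_product_measure1 d1 d2 (T1 : measurableType d1)
    (T2 : measurableType d2) (R : realType)
    (m1 : {sigma_finite_measure set T1 -> \bar R})
    (m2 : {sigma_finite_measure set T2 -> \bar R}) :
  sigma_finite setT (m1 \x m2)%E.
Proof.
have /sigma_finiteP[F [TF ndF Foo]] := sigma_finiteT m1.
have /sigma_finiteP[G [TG ndG Goo]] := sigma_finiteT m2.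
exists (fun k => F k `*` G k).
  rewrite -setXTT TF TG predeqE => -[x y]; split.
    move=> [/= [i _ Fix] [j _ Gjy]]; exists (maxn i j) => //; split.
    - by move: x Fix; exact/subsetPset/ndF/leq_maxl.
    - by move: y Gjy; exact/subsetPset/ndG/leq_maxr.
  by move=> [i _ []/= ? ?]; split; exists i.
move=> k; have [? ?] := Foo k; have [? ?] := Goo k.
split; first exact: measurableX.
by rewrite product_measure1E// lte_mul_pinfty// ge0_fin_numE.
Qed.

Section lebesgue_rV_succ.
Context {R : realType} (n : nat).
Variable m : {sigma_finite_measure set 'rV[R]_n -> \bar R}.

Definition lebesgue_rV_succ : set 'rV[R]_n.+1 -> \bar R :=
  pushforward (lebesgue_measure \x m)%E (@rV_cons R n).

Let mcons := @measurable_rV_cons R n.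

Let succ0 : lebesgue_rV_succ set0 = 0%E.
Proof. by rewrite /lebesgue_rV_succ /pushforward preimage_set0 measure0. Qed.

Let succ_ge0 A : (0 <= lebesgue_rV_succ A)%E.
Proof. exact: measure_ge0. Qed.

Let succ_sigma_additive : semi_sigma_additive lebesgue_rV_succ.
Proof. by apply: measure_semi_sigma_additive; exact: mcons. Qed.

HB.instance Definition _ := isMeasure.Build _ _ _ lebesgue_rV_succ
  succ0 succ_ge0 succ_sigma_additive.

Let succ_sigma_finite : sigma_finite setT lebesgue_rV_succ.
Proof.
have [F FT Foo] : sigma_finite setT (lebesgue_measure \x m)%E.
  exact: sigma_finite_product_measure1.
exists (fun k => @rV_uncons R n @^-1` F k).
  by rewrite -preimage_bigcup -FT preimage_setT.
move=> k; have [mF Fk] := Foo k; split.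
  by rewrite -[X in measurable X]setTI; exact: measurable_rV_uncons.
rewrite /lebesgue_rV_succ /pushforward -comp_preimage.
rewrite (_ : _ \o _ = id) ?preimage_id//.
by apply/funext => u; exact: rV_consK.
Qed.

HB.instance Definition _ := Measure_isSigmaFinite.Build _ _ _ lebesgue_rV_succ
  succ_sigma_finite.

End lebesgue_rV_succ.

Fixpoint lebesgue_rV (R : realType) (n : nat) :
    {sigma_finite_measure set 'rV[R]_n -> \bar R} :=
  match n with
  | 0 => dirac (0 : 'rV[R]_0)
  | k.+1 => lebesgue_rV_succ (lebesgue_rV R k)
  end.

Definition dotv (R : realType) n (u v : 'rV[R]_n) : R :=
  \sum_(i < n) u ord0 i * v ord0 i.

(* The space underlying the Heisenberg group, with points ((x, y), t); it is an
   abbreviation so that the product topology, normed module and sigma-algebra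
   are found by inference. *)
Notation heis R n := ('rV[R]_n * 'rV[R]_n * R)%type.

Section heisenberg.
Context {R : realType} {n : nat}.

Definition heis_mul (xi xi' : heis R n) : heis R n :=
  (xi.1.1 + xi'.1.1, xi.1.2 + xi'.1.2,
   xi.2 + xi'.2 + 2 * dotv xi.1.2 xi'.1.1 - 2 * dotv xi.1.1 xi'.1.2).

Definition heis_inv (xi : heis R n) : heis R n := - xi.

(* The Euclidean norm on R^n * R^n: the library's norm on this product is the
   sup norm. *)
Definition eucl_norm (z : 'rV[R]_n * 'rV[R]_n) : R :=
  Num.sqrt (dotv z.1 z.1 + dotv z.2 z.2).

Definition heis_norm (xi : heis R n) : R :=
  (eucl_norm xi.1 ^+ 4 + xi.2 ^+ 2) `^ (4^-1).

Definition lebesgue_rV2 : set ('rV[R]_n * 'rV[R]_n) -> \bar R :=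
  (lebesgue_rV R n \x lebesgue_rV R n)%E.

HB.instance Definition _ := Measure.on lebesgue_rV2.
HB.instance Definition _ := Measure_isSigmaFinite.Build _ _ _ lebesgue_rV2
  (sigma_finite_product_measure1 (lebesgue_rV R n) (lebesgue_rV R n)).

Definition heis_measure :
    set ('rV[R]_n * 'rV[R]_n * measurableTypeR R) -> \bar R :=
  (lebesgue_rV2 \x lebesgue_measure)%E.

HB.instance Definition _ := Measure.on heis_measure.
HB.instance Definition _ := Measure_isSigmaFinite.Build _ _ _ heis_measure
  (sigma_finite_product_measure1 lebesgue_rV2 lebesgue_measure).

Definition heis_dim : nat := (2 * n + 2)%N.

Definition x1 (hn : (0 < n)%N) (xi : heis R n) : R :=
  xi.1.1 ord0 (Ordinal hn).

Definition halfspace (hn : (0 < n)%N) : set (heis R n) :=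
  [set xi | 0 < x1 hn xi].

End heisenberg.

Arguments lebesgue_rV2 : clear implicits.
Arguments heis_measure : clear implicits.
Arguments heis_dim : clear implicits.

(* On a finite-dimensional space, f is of class C^(k+1) if and only if it is
   differentiable and all its directional derivatives are of class C^k. *)
Fixpoint class_C (R : realType) (V : normedModType R) (k : nat) (f : V -> R) :
    Prop :=
  match k with
  | 0 => continuous f
  | k'.+1 => (forall x, differentiable f x) /\ forall v, class_C k' ('D_v f)
  end.

Definition smooth (R : realType) (V : normedModType R) (f : V -> R) : Prop :=
  forall k, class_C k f.

(* Functions in C_c^oo(H^n_+), given by their extension by zero to H^n: smooth
   functions on H^n whose (closed) support is a compact subset of the open half
   space. *)
Definition Cc_smooth_halfspace (R : realType) n (hn : (0 < n)%N)
    (f : heis R n -> R) : Prop :=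
  [/\ smooth f, compact (closure [set xi | f xi != 0])
    & closure [set xi | f xi != 0] `<=` halfspace hn].

(* Main.v *)
Require Import Defs.
From mathcomp Require Import all_boot all_order all_algebra.
From mathcomp Require Import all_classical all_reals all_analysis.
From mathcomp Require Import measurable_realfun ring lra.

(** Let G(eta) be the integral over xi of |f(xi) - f(xi o eta)|^p, and k(eta)
    the kernel d(eta)^-(Q + s p) |w|^-alpha, with w the horizontal part of eta.
    Since left translations preserve the measure, Tonelli's theorem turns the
    double integral into the integral of k G ([gagliardo_translation]).

    The heart of the matter is a lower bound for G(eta) for each single eta with
    h := x_1(eta) > 0, namely (p - 1) times the integral of
    (h / (2 (x_1 + h)))^p |f|^p over the half-space ([hardy_translation]).  This
    is a discrete Hardy inequality along the orbits of the right translation by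
    eta: x_1 grows by h at every step and f vanishes where x_1 <= 0.  It is
    proved without decomposing into orbits.  A pointwise convexity inequality,
    in which the ratio of the weights depends on x_1 ([powR_quotient_le]), is
    integrated, and the invariance of the measure under right translations makes
    the weights telescope, up to a gain ([powR_odds_ge]) that is the left-hand
    side.

    The bound depends on eta only through h.  So it suffices to integrate over
    the cone where all coordinates of w are at most h in absolute value and the
    vertical coordinate is at most h^2.  There k(eta) is at least a constant
    times h^-(Q + s p + alpha) ([heis_kernel_cone]), and the slice of the cone
    at height h has measure 2^(2n) h^(2n+1) ([integral_heis_cone]).  After one
    more exchange of integrals, the factor of |f(xi)|^p is a constant times
    the integral over h > 0 of h^-(1 + s p + alpha) (h / (2 (x_1 + h)))^p
    ([integral_kernel_ge]).  Its part h < x_1 is at least of the order of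
    x_1^-(s p + alpha) / (1 - s), and its part h > x_1 is of the order of
    x_1^-(s p + alpha) / (s + alpha / p).  Since 1 - s and s + alpha / p add up
    to at least 1, this yields the stated dependence on s.

    The measure is built from products of Lebesgue measures.  Its invariance and
    the volumes are obtained by slicing ([measure_preserving_skew],
    [integral_slice]). *)

Set Implicit Arguments.
Unset Strict Implicit.
Unset Printing Implicit Defensive.

Import Order.TTheory GRing.Theory Num.Theory.
Import numFieldNormedType.Exports.

Local Open Scope classical_set_scope.
Local Open Scope ring_scope.

(** The Heisenberg group as a measurable space; [heis R n] is the same type,
    with the topology and vector space structure of [R] in the last factor. *)
Local Notation mheis R n := ('rV[R]_n * 'rV[R]_n * measurableTypeR R)%type.

(** * Power inequalities behind the discrete Hardy inequality *)

Section scalar.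
Context {R : realType}.
Implicit Types (p q u a b c x : R).

(** Convexity of [t `^ p] for [|a| <= |a - b| + |b|], with weights [q / (1 + q)]
    and [1 / (1 + q)]: these make the coefficient of [|a - b| `^ p] equal to 1,
    while [q] stays free, to be chosen as a function of the point. *)
Lemma powR_quotient_le p q a b : 1 < p -> 0 < q ->
  (q / (1 + q)) `^ (p - 1) * `|a| `^ p <=
  `|a - b| `^ p + q `^ (p - 1) * `|b| `^ p.
Proof.
move=> p1 q0.
have p0 : 0 < p by rewrite (lt_trans _ p1).
have q10 : 0 < 1 + q by rewrite addr_gt0.
set t := (1 + q)^-1; set w := q / (1 + q).
have t0 : 0 < t by rewrite invr_gt0.
have w0 : 0 < w by rewrite divr_gt0.
have wt : w + t = 1 by rewrite /w /t; field; rewrite gt_eqF.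
have w1 : w <= 1 by rewrite -wt lerDl ltW.
have x0 : 0 <= `|a - b| / w by rewrite divr_ge0// ltW.
have y0 : 0 <= `|b| / t by rewrite divr_ge0// ltW.
have tE : 1 - w = t by rewrite -wt addrAC subrr add0r.
have cvx : (w * (`|a - b| / w) + t * (`|b| / t)) `^ p <=
    w * (`|a - b| / w) `^ p + t * (`|b| / t) `^ p.
  have := @convex_powR R p (ltW p1) (Itv01 (ltW w0) w1)
    (`|a - b| / w) (`|b| / t).
  rewrite !inE/= !in_itv/= !andbT => /(_ x0 y0).
  by move=> cvx; rewrite -{1 3}tE; exact: cvx.
have wE : w * w `^ (p - 1) = w `^ p by rewrite mulr_powRB1// ltW.
have qE : t `^ p * q `^ (p - 1) = t * w `^ (p - 1).
  rewrite -(mulr_powRB1 (ltW t0) p0) -mulrA -powRM ?ltW//.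
  by rewrite /w /t mulrC [in RHS]mulrC (mulrC q).
have le1 : `|a| `^ p <= (w * (`|a - b| / w) + t * (`|b| / t)) `^ p.
  apply: (ge0_ler_powR (ltW p0)); rewrite ?nnegrE//.
    by rewrite addr_ge0// mulr_ge0// ltW.
  rewrite (mulrC w) (mulrC t) !divfK ?gt_eqF//.
  by rewrite -{1}(subrK b a) ler_normD.
rewrite (le_trans (ler_wpM2l (powR_ge0 _ _) (le_trans le1 cvx)))//.
rewrite mulrDr; apply: lerD.
  rewrite mulrA (mulrC _ w) wE -powRM ?(ltW w0)//.
  by rewrite mulrC divfK// gt_eqF.
rewrite mulrA (mulrC _ t) -qE mulrAC -powRM ?(ltW t0)//.
by rewrite (mulrC t) divfK ?gt_eqF// mulrC.
Qed.

(** After division by [u `^ (p - 1)] this reads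
    [(1 - u) `^ (1 - p) >= 1 + (p - 1) * u], which holds because
    [ln (1 - u) <= - u] and [expR y >= 1 + y].  The surplus [(p - 1) * u `^ p]
    is what remains on the left of the Hardy inequality. *)
Lemma powR_odds_ge p u : 1 < p -> 0 < u -> u < 1 ->
  u `^ (p - 1) + (p - 1) * u `^ p <= (u / (1 - u)) `^ (p - 1).
Proof.
move=> p1 u0 u1.
have p0 : 0 < p by rewrite (lt_trans _ p1).
have v0 : 0 < 1 - u by rewrite subr_gt0.
rewrite powRM ?invr_ge0 ?(ltW u0) ?(ltW v0)// -(mulr_powRB1 (ltW u0) p0) mulrA.
rewrite -{1}(mul1r (_ `^ _)) -mulrDl mulrC ler_pM2l ?powR_gt0//.
rewrite -powR_inv1 ?(ltW v0)// -powRrM mulN1r /powR gt_eqF//.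
apply: (le_trans (expR_ge1Dx _)); rewrite ler_expR mulNr -mulrN.
rewrite ler_pM2l ?subr_gt0// lerNr.
by apply: le_ln1Dx; rewrite ltrN2.
Qed.

Lemma continuous_within_powR c a b : 0 < a ->
  {within `[a, b], continuous (fun x : R => x `^ c)}.
Proof.
move=> a0; apply: derivable_within_continuous => x.
rewrite in_itv/= => /andP[ax _]; apply: derivable_powR.
by rewrite in_itv/= andbT (lt_le_trans a0).
Qed.

Lemma integral_powR c a b : c != 0 -> 0 < a -> a < b ->
  (\int[lebesgue_measure]_(x in `[a, b]) (x `^ (c - 1))%:E =
   ((b `^ c - a `^ c) / c)%:E)%E.
Proof.
move=> c0 a0 ab; pose F (x : R) := c^-1 * x `^ c.
have dF (x : R) : 0 < x -> is_derive x 1 F (c^-1 * (c * x `^ (c - 1))).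
  move=> x0; have := is_derive1_powR c x0 => H.
  by apply: is_deriveZ.
have cF (x : R) : 0 < x -> F @ x --> F x.
  move=> x0; apply: differentiable_continuous.
  by apply/derivable1_diffP; have [] := dF _ x0.
rewrite (@continuous_FTC2 _ _ F)//.
- by rewrite -EFinB /F -mulrBr mulrC.
- exact: continuous_within_powR.
- split.
  + move=> x; rewrite in_itv/= => /andP[ax _].
    by have [] := dF x (lt_trans a0 ax).
  + by apply: cvg_at_right_filter; exact: cF.
  + by apply: cvg_at_left_filter; apply: cF; exact: lt_trans ab.
- move=> x; rewrite in_itv/= => /andP[ax _].
  rewrite derive1E; have [_ ->] := dF x (lt_trans a0 ax).
  by rewrite mulrA mulVf// mul1r.
Qed.

End scalar.

(** * The one-dimensional Hardy kernel *)

(** Powers with a fixed exponent are measurable, and [y^-1] is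
    [y * (y ^+ 2) `^ (-1)], also at [y = 0]. *)
Lemma measurable_fun_invr d (T : measurableType d) (R : realType) (D : set T)
    (f : T -> R) :
  measurable_fun D f -> measurable_fun D (fun x => (f x)^-1).
Proof.
move=> mf.
rewrite (_ : (fun x => _) = (fun x => f x * (f x ^+ 2) `^ (-1))).
  apply: measurable_funM => //.
  exact: (measurableT_comp (@measurable_powR R (-1)) (measurable_funX 2 mf)).
apply/funext => x; rewrite powR_inv1 ?sqr_ge0//.
have [->|fx0] := eqVneq (f x) 0; first by rewrite invr0 mul0r.
by rewrite expr2 invfM mulrA divff// mul1r.
Qed.

(** The integral of a nonnegative function is the supremum of the integrals of
    the simple functions below it, so it can only grow with the function and
    with the domain. *)
Lemma ge0_le_subset_integral d (T : measurableType d) (R : realType)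
    (mu : {measure set T -> \bar R}) (D E : set T) (f g : T -> \bar R) :
  D `<=` E -> (forall x, D x -> 0 <= f x)%E -> (forall x, E x -> 0 <= g x)%E ->
  (forall x, D x -> f x <= g x)%E ->
  (\int[mu]_(x in D) f x <= \int[mu]_(x in E) g x)%E.
Proof.
move=> DE f0 g0 fg; rewrite !ge0_integralE//.
apply: le_ereal_sup => _ [h hf <-]; exists h => // x.
apply: (le_trans (hf x)); rewrite /patch.
case: ifPn => [/[!inE] Dx|_].
  by rewrite (_ : x \in E) ?fg// inE; exact: DE.
by case: ifPn => // /[!inE]; exact: g0.
Qed.

Section kernel.
Context {R : realType}.
Local Notation mu := (@lebesgue_measure R).

(** This weight telescopes: if [u] is its value at [x], the odds of its value at
    [x + h] are [u / (1 + u)].  So the bound of [powR_quotient_le] at [x + h]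
    matches that of [powR_odds_ge] at [x]. *)
Definition hardy_weight (h x : R) : R := h / (2 * (x + h)).

Lemma hardy_weight_itv h x : 0 < h -> 0 < x ->
  0 < hardy_weight h x /\ hardy_weight h x < 1.
Proof.
move=> h0 x0; have xh : 0 < 2 * (x + h) by rewrite mulr_gt0// addr_gt0.
split; first by rewrite divr_gt0.
by rewrite ltr_pdivrMr// mul1r; lra.
Qed.

Lemma measurable_hardy_weight d (T : measurableType d) (h x : T -> R) :
  measurable_fun setT h -> measurable_fun setT x ->
  measurable_fun setT (fun u => hardy_weight (h u) (x u)).
Proof.
move=> mh mx; apply: measurable_funM => //.
apply: measurable_fun_invr; apply: measurable_funM => //.
exact: measurable_funD.
Qed.

Lemma measurable_powR_comp d (T : measurableType d) (h : T -> R) (q : R) :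
  measurable_fun setT h -> measurable_fun setT (fun u => h u `^ q).
Proof. by move=> mh; exact: measurableT_comp (@measurable_powR R q) mh. Qed.

Lemma hardy_weight_ge (p x h c : R) : 0 < p -> 0 < h -> 0 < x ->
  h <= c -> x <= c -> (4^-1 * (h / c)) `^ p <= hardy_weight h x `^ p.
Proof.
move=> p0 h0 x0 hc xc; rewrite /hardy_weight.
have c0 : 0 < c by rewrite (lt_le_trans h0).
have xh0 : 0 < 2 * (x + h) by rewrite mulr_gt0// addr_gt0.
apply: (ge0_ler_powR (ltW p0)).
- by rewrite nnegrE mulr_ge0// divr_ge0 ?ltW.
- by rewrite nnegrE divr_ge0 ?ltW.
rewrite mulrCA ler_pM2l// -invfM lef_pV2 ?posrE ?mulr_gt0//; lra.
Qed.

(** The weight is at least [h / (4 * x)] on [(0, x)] and at least [1 / 4] beyond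
    [x].  The integral over [(0, x)] is thus at least of the order of
    [x `^ (- b) / (p * (1 - s))], and the integral over [(x, +oo)] at least of
    the order of [x `^ (- b) / b], where [b = s * p + alpha = p * (s + alpha / p)].  One of
    [1 - s] and [s + alpha / p] is at least [1 / 2], so that the piece which
    carries the other factor already gives the bound. *)
Lemma integral_kernel_ge (p s alpha x : R) :
  1 < p -> 0 < s -> s < 1 -> 0 <= alpha -> 0 < x ->
  ((x `^ (- (s * p + alpha)) *
      (4^-1 `^ p / (4 * p) / ((s + alpha / p) * (1 - s))))%:E <=
   \int[mu]_(h in `]0%R, +oo[)
     (h `^ (- (s * p + alpha) - 1) * hardy_weight h x `^ p)%:E)%E.
Proof.
move=> p1 s0 s1 al0 x0.
have p0 : 0 < p by rewrite (lt_trans _ p1).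
have A0 : 0 < p * (1 - s) by rewrite mulr_gt0// subr_gt0.
set b := s * p + alpha.
have b0 : 0 < b by rewrite ltr_wpDr// mulr_gt0.
pose f h := (h `^ (- b - 1) * hardy_weight h x `^ p)%:E.
rewrite -[leRHS]/(\int[mu]_(h in `]0%R, +oo[) f h)%E.
have f0 (h : R) : (0 <= f h)%E by rewrite lee_fin mulr_ge0// powR_ge0.
set sg := s + alpha / p.
have sgE : b = sg * p by rewrite /b /sg mulrDl divfK// gt_eqF.
have sg0 : 0 < sg by rewrite ltr_wpDr// divr_ge0// ltW.
have [s2|s2] := leP 2^-1 s.
- (* [e] is such that the integral of h `^ (p * (1 - s) - 1) over [e * x, x] is
     exactly half of the integral over (0, x]. *)
  pose e : R := 2^-1 `^ (p * (1 - s))^-1.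
  have e0 : 0 < e by rewrite powR_gt0.
  have eA : e `^ (p * (1 - s)) = 2^-1.
    by rewrite -powRrM mulVf ?powRr1// gt_eqF.
  have e1 : e < 1.
    rewrite ltNge; apply/negP => e1.
    have := @ge0_ler_powR _ _ (ltW A0) 1 e.
    by rewrite !nnegrE eA powR1 => /(_ ler01 (ltW e0) e1); lra.
  have ex0 : 0 < e * x by rewrite mulr_gt0.
  have exx : e * x < x by rewrite gtr_pMl.
  pose k := 4^-1 `^ p * x `^ (- p - alpha).
  have k0 : 0 <= k by rewrite mulr_ge0 ?powR_ge0.
  have le1 : (\int[mu]_(h in `[(e * x)%R, x])
      (k%:E * (h `^ (p * (1 - s) - 1))%:E) <=
      \int[mu]_(h in `]0%R, +oo[) f h)%E.
    apply: ge0_le_subset_integral => //.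
    + move=> h/=; rewrite !in_itv/= => /andP[h1 _].
      by rewrite andbT (lt_le_trans _ h1).
    + by move=> h _; rewrite -EFinM lee_fin mulr_ge0 ?powR_ge0.
    + move=> h/=; rewrite in_itv/= => /andP[h1 hx].
      have h0 : 0 < h by rewrite (lt_le_trans _ h1).
      rewrite lee_fin (le_trans _ (ler_wpM2l (powR_ge0 _ _)
        (hardy_weight_ge p0 h0 x0 hx (lexx x))))//.
      rewrite powRM ?divr_ge0 ?(ltW h0) ?(ltW x0)//.
      rewrite powRM ?invr_ge0 ?(ltW h0) ?(ltW x0)//.
      rewrite -(powR_inv1 (ltW x0)) -powRrM mulN1r /k.
      rewrite powRD ?(gt_eqF x0) ?implybT//.
      (* For alpha > 0 the kernel is even larger near 0, possibly not
         integrable; h `^ (- alpha) >= x `^ (- alpha) reduces it to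
         alpha = 0. *)
      rewrite (_ : p * (1 - s) - 1 = (- b - 1) + p + alpha); last first.
        by rewrite /b; ring.
      rewrite [in leLHS]powRD ?(gt_eqF h0) ?implybT//.
      rewrite [in leLHS]powRD ?(gt_eqF h0) ?implybT//.
      rewrite [leLHS](_ : _ = (x `^ (- alpha) * h `^ alpha) *
        (h `^ (- b - 1) * (4^-1 `^ p * (h `^ p * x `^ (- p))))); last by ring.
      rewrite ler_piMl//.
        by rewrite !mulr_ge0// powR_ge0.
      rewrite powRN mulrC ler_pdivrMr ?powR_gt0// mul1r.
      by apply: (ge0_ler_powR al0); rewrite ?nnegrE ?(ltW h0) ?(ltW x0).
  apply: (le_trans _ le1).
  rewrite ge0_integralZl//; last 2 first.
    + apply/measurable_EFinP; apply: measurable_funTS; exact: measurable_powR.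
    + by move=> h _; rewrite lee_fin powR_ge0.
  rewrite integral_powR// ?gt_eqF// -EFinM lee_fin.
  rewrite powRM ?(ltW e0) ?(ltW x0)// eA.
  rewrite (_ : - b = (- p - alpha) + p * (1 - s)); last by rewrite /b; ring.
  rewrite powRD ?(gt_eqF x0) ?implybT// /k.
  set P := 4^-1 `^ p; set X := x `^ (- p - alpha); set Y := x `^ (p * (1 - s)).
  rewrite [leLHS](_ : _ = (P * X * Y / p / (1 - s)) * (4 * sg)^-1); last first.
    by field; rewrite ?gt_eqF// subr_gt0.
  rewrite [leRHS](_ : _ = (P * X * Y / p / (1 - s)) * 2^-1); last first.
    by field; rewrite ?gt_eqF// subr_gt0.
  apply: ler_wpM2l.
    by rewrite !divr_ge0 ?mulr_ge0 ?powR_ge0 ?(ltW p0)// subr_ge0 ltW.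
  rewrite lef_pV2 ?posrE ?mulr_gt0//.
  have : s <= sg by rewrite lerDl divr_ge0// ltW.
  lra.
- (* Likewise [x, K * x] carries half of the integral of h `^ (- b - 1) over
     [x, +oo). *)
  pose K : R := 2 `^ b^-1.
  have K0 : 0 < K by rewrite powR_gt0.
  have KA : K `^ (- b) = 2^-1.
    by rewrite powRN -powRrM mulVf ?powRr1// gt_eqF.
  have K1 : 1 < K.
    rewrite ltNge; apply/negP => K1.
    have := @ge0_ler_powR _ _ (ltW b0) K 1.
    rewrite !nnegrE powR1 => /(_ (ltW K0) ler01 K1).
    by rewrite -powRrM mulVf ?powRr1 ?gt_eqF//; lra.
  have xKx : x < K * x by rewrite ltr_pMl.
  pose k : R := 4^-1 `^ p.
  have k0 : 0 <= k by rewrite powR_ge0.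
  have le1 : (\int[mu]_(h in `[x, (K * x)%R])
      (k%:E * (h `^ (- b - 1))%:E) <= \int[mu]_(h in `]0%R, +oo[) f h)%E.
    apply: ge0_le_subset_integral => //.
    + move=> h/=; rewrite !in_itv/= => /andP[h1 _].
      by rewrite andbT (lt_le_trans _ h1).
    + by move=> h _; rewrite -EFinM lee_fin mulr_ge0 ?powR_ge0.
    + move=> h/=; rewrite in_itv/= => /andP[xh _].
      have h0 : 0 < h by rewrite (lt_le_trans _ xh).
      rewrite lee_fin (le_trans _ (ler_wpM2l (powR_ge0 _ _)
        (hardy_weight_ge p0 h0 x0 (lexx h) xh)))//.
      by rewrite divff ?gt_eqF// mulr1 mulrC.
  apply: (le_trans _ le1).
  rewrite ge0_integralZl//; last 2 first.
    + apply/measurable_EFinP; apply: measurable_funTS; exact: measurable_powR.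
    + by move=> h _; rewrite lee_fin powR_ge0.
  rewrite integral_powR// ?oppr_eq0 ?gt_eqF// -EFinM lee_fin.
  rewrite powRM ?(ltW K0) ?(ltW x0)// KA /k sgE.
  set P := 4^-1 `^ p; set X := x `^ _.
  rewrite [leLHS](_ : _ = (P * X / p / sg) * (4 * (1 - s))^-1); last first.
    by field; rewrite ?gt_eqF// subr_gt0.
  rewrite [leRHS](_ : _ = (P * X / p / sg) * 2^-1); last first.
    by field; rewrite ?gt_eqF// subr_gt0.
  apply: ler_wpM2l.
    by rewrite !divr_ge0 ?mulr_ge0 ?powR_ge0 ?(ltW p0) ?(ltW sg0).
  by rewrite lef_pV2 ?posrE ?mulr_gt0 ?subr_gt0//; lra.
Qed.

End kernel.

(** * Measure-preserving maps, slicing, and Lebesgue measure on row vectors *)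

Definition measure_preserving d (T : measurableType d) (R : realType)
    (mu : set T -> \bar R) (phi : T -> T) : Prop :=
  measurable_fun setT phi /\
  forall A, measurable A -> mu (phi @^-1` A) = mu A.

Lemma measure_preserving_integral d (T : measurableType d) (R : realType)
    (mu : {measure set T -> \bar R}) (phi : T -> T) (f : T -> \bar R) :
  measure_preserving mu phi -> measurable_fun setT f ->
  (forall x, 0 <= f x)%E ->
  (\int[mu]_x f (phi x) = \int[mu]_x f x)%E.
Proof.
move=> [mphi muphi] mf f0.
have := @ge0_integral_pushforward _ _ _ _ R _ mphi mu setT f measurableT mf
  (fun y _ => f0 y).
rewrite preimage_setT => <-.
by apply: eq_measure_integral => //= A mA _; rewrite /pushforward muphi.
Qed.

(** By Tonelli in the first variable: the section at [x] of the preimage of [A]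
    is the preimage under [b x] of the section of [A] at [a x].  This is the
    form of the translations of the Heisenberg group, where the shift of [t]
    depends on [z]. *)
Lemma measure_preserving_skew d1 d2 (T1 : measurableType d1)
    (T2 : measurableType d2) (R : realType)
    (m1 : {sigma_finite_measure set T1 -> \bar R})
    (m2 : {sigma_finite_measure set T2 -> \bar R})
    (a : T1 -> T1) (b : T1 -> T2 -> T2) :
  measure_preserving m1 a -> (forall x, measure_preserving m2 (b x)) ->
  measurable_fun setT (fun u : T1 * T2 => b u.1 u.2) ->
  measure_preserving (m1 \x m2)%E (fun u => (a u.1, b u.1 u.2)).
Proof.
move=> [ma m1a] hb mb.
have mab : measurable_fun setT (fun u : T1 * T2 => (a u.1, b u.1 u.2)).
  by apply: measurable_fun_pair => //; exact: measurableT_comp.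
split=> // A mA; rewrite /product_measure1.
transitivity (\int[m1]_x (m2 \o xsection A) (a x))%E.
  apply: eq_integral => x _ /=; have [_ hbx] := hb x.
  rewrite -(hbx (xsection A (a x))); last exact: measurable_xsection.
  by congr (m2 _); apply/seteqP; split => y /=; rewrite /xsection/= !inE.
apply: measure_preserving_integral => //.
exact: measurable_fun_xsection.
Qed.

Lemma integral_slice d1 d2 (T1 : measurableType d1) (T2 : measurableType d2)
    (R : realType) (m1 : {sigma_finite_measure set T1 -> \bar R})
    (m2 : {sigma_finite_measure set T2 -> \bar R})
    (E : set (T1 * T2)) (g : T1 -> R) :
  measurable E -> measurable_fun setT g -> (forall x, 0 <= g x) ->
  (\int[m1 \x m2]_u (g u.1 * \1_E u)%:E =
   \int[m1]_x ((g x)%:E * m2 (xsection E x)))%E.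
Proof.
move=> mE mg g0.
rewrite fubini_tonelli1//=; last 2 first.
- apply/measurable_EFinP; apply: measurable_funM.
    exact: measurableT_comp.
  exact: measurable_indic.
- by move=> u; rewrite lee_fin mulr_ge0.
apply: eq_integral => x _; rewrite /fubini_F/=.
under eq_integral do rewrite EFinM.
rewrite ge0_integralZl//; last 2 first.
- apply/measurable_EFinP.
  have mI : measurable_fun setT (\1_E : T1 * T2 -> R).
    exact: measurable_indic.
  exact: (measurable_fun_pair2 x mI).
- by rewrite lee_fin.
congr (_ * _)%E.
rewrite -[X in m2 X]setIT -integral_indic//; last exact: measurable_xsection.
by apply: eq_integral => y _; rewrite !indicE mem_xsection.
Qed.

Section lebesgue_rV.
Context {R : realType}.
Notation mu := (@lebesgue_measure R).

(** Both sides are measures, and they agree on intervals open on the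
    left and closed on the right. *)
Lemma measure_preserving_addl (a : R) :
  measure_preserving mu (fun y => a + y : measurableTypeR R).
Proof.
pose tau (y : measurableTypeR R) : measurableTypeR R := a + y.
have mtau : measurable_fun setT tau by exact: measurable_funD.
split=> // A mA; rewrite -/(pushforward mu tau A); apply/esym.
apply: lebesgue_measure_unique => //= _ [[b c]] _ <-.
rewrite /pushforward.
rewrite (_ : tau @^-1` _ = `](b - a), (c - a)]%classic); last first.
  by apply/seteqP; split=> y/=; rewrite !in_itv/= ltrBlDl lerBrDl.
rewrite !lebesgue_measure_itv/= !lte_fin ltrD2r.
by case: ifPn => // _; rewrite -EFinB; congr EFin; ring.
Qed.

Lemma measurable_rV_addl n (v : 'rV[R]_n) :
  measurable_fun setT (fun w => v + w).
Proof.
apply/measurable_fun_rVP => i; under eq_fun do rewrite mxE.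
by apply: measurable_funD => //; exact: measurable_rV_coord.
Qed.

Lemma rV_consD n (u w : measurableTypeR R * 'rV[R]_n) :
  rV_cons u + rV_cons w = rV_cons (u.1 + w.1, u.2 + w.2).
Proof.
rewrite /rV_cons [LHS](@add_row_mx _ 1 1 n).
rewrite (_ : const_mx u.1 + _ = const_mx (u.1 + w.1))//.
by apply/rowP => i; rewrite !mxE.
Qed.

Lemma measure_preserving_rV_addl n (v : 'rV[R]_n) :
  measure_preserving (lebesgue_rV R n) (fun w => v + w).
Proof.
elim: n v => [|n IH] v.
  split; first exact: measurable_rV_addl.
  move=> A mA; rewrite (_ : (fun w => v + w) = id) ?preimage_id//.
  by apply/funext => w; rewrite [LHS]thinmx0 [RHS]thinmx0.
split; first exact: measurable_rV_addl.
move=> A mA /=; rewrite /lebesgue_rV_succ /pushforward.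
have mcA : measurable (@rV_cons R n @^-1` A).
  by rewrite -[X in measurable X]setTI; exact: measurable_rV_cons.
have [_ H] := measure_preserving_skew
  (measure_preserving_addl (rV_uncons v).1)
  (fun=> IH (rV_uncons v).2)
  (measurableT_comp (measurable_rV_addl (rV_uncons v).2) measurable_snd).
rewrite -(H _ mcA); congr ((_ \x _)%E _); apply/funext => -[a w].
by rewrite /preimage/mkset -{1}(rV_unconsK v) rV_consD.
Qed.

Lemma rV_cons0 n (u : measurableTypeR R * 'rV[R]_n) : rV_cons u ord0 ord0 = u.1.
Proof. exact: (congr1 fst (rV_consK u)). Qed.

Lemma rV_consS n (u : measurableTypeR R * 'rV[R]_n) i :
  rV_cons u ord0 (lift ord0 i) = u.2 ord0 i.
Proof. by have /(congr1 snd)/rowP/(_ i) := rV_consK u; rewrite /= mxE. Qed.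

Definition rV_box n (h : R) : set 'rV[R]_n :=
  [set v | forall i, `|v ord0 i| <= h].

Lemma measurable_rV_box n h : measurable (@rV_box n h).
Proof.
rewrite (_ : rV_box h = \bigcap_(i in [set: 'I_n])
    ((fun v : 'rV[R]_n => v ord0 i : measurableTypeR R) @^-1` `[- h, h])).
  apply: fin_bigcap_measurable => // i _.
  by rewrite -[X in measurable X]setTI; exact: measurable_rV_coord.
apply/seteqP; split => v /=.
  by move=> vh i _ /=; rewrite in_itv/= -ler_norml; exact: vh.
by move=> vh i; have := vh i I; rewrite /= in_itv/= -ler_norml.
Qed.

Lemma lebesgue_rV_box n (h : R) : 0 <= h ->
  lebesgue_rV R n (rV_box h) = ((2 * h) ^+ n)%:E.
Proof.
move=> h0; elim: n => [|n IH].
  by rewrite expr0 /= diracE mem_set// => -[].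
rewrite /= /lebesgue_rV_succ /pushforward.
rewrite (_ : _ @^-1` _ = `[- h, h]%classic `*` @rV_box n h).
  rewrite product_measure1E//; last exact: measurable_rV_box.
  rewrite IH [X in (X * _)%E](lebesgue_measure_itv `[- h, h])/= lte_fin.
  rewrite exprS EFinM.
  case: ltP => [_|hh]; first by rewrite -EFinB opprK; congr (_%:E * _)%E; ring.
  have -> : h = 0 by apply/eqP; rewrite eq_le h0 andbT; lra.
  by rewrite mulr0 mul0e.
apply/seteqP; split => u /=; rewrite in_itv/= -ler_norml.
  move=> uh; split; first by have := uh ord0; rewrite rV_cons0.
  by move=> i; have := uh (lift ord0 i); rewrite rV_consS.
move=> [ah vh] i; case: (unliftP ord0 i) => [j|] ->.
  by rewrite rV_consS.
by rewrite rV_cons0.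
Qed.

End lebesgue_rV.

(** * Continuous functions on the Heisenberg group are measurable *)

Section heis_measurable.
Context {R : realType} {n : nat}.
Local Notation H := (mheis R n).

Lemma measurable_ler_set d (T : measurableType d) (f g : T -> R) :
  measurable_fun setT f -> measurable_fun setT g ->
  measurable [set x | f x <= g x].
Proof.
by move=> mf mg; rewrite -[X in measurable X]setTI; exact: measurable_fun_le.
Qed.

Lemma measurable_ltr_set d (T : measurableType d) (f g : T -> R) :
  measurable_fun setT f -> measurable_fun setT g ->
  measurable [set x | f x < g x].
Proof.
move=> mf mg; rewrite (_ : [set x | _] = ~` [set x | g x <= f x]).
  by apply: measurableC; exact: measurable_ler_set.
by apply/seteqP; split => x /=; rewrite ltNge => /negP.
Qed.

Lemma measurable_fun_dotv d (T : measurableType d) (f g : T -> 'rV[R]_n) :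
  measurable_fun setT f -> measurable_fun setT g ->
  measurable_fun setT (fun x => dotv (f x) (g x)).
Proof.
move=> /measurable_fun_rVP mf /measurable_fun_rVP mg.
apply: (@measurable_sum _ _ _ _ _ _
  (fun i x => f x ord0 i * g x ord0 i)) => i.
exact: measurable_funM (mf i) (mg i).
Qed.

Lemma measurable_heis_x : measurable_fun setT (fun xi : H => xi.1.1).
Proof. exact: (measurableT_comp measurable_fst measurable_fst). Qed.

Lemma measurable_heis_y : measurable_fun setT (fun xi : H => xi.1.2).
Proof. exact: (measurableT_comp measurable_snd measurable_fst). Qed.

Lemma measurable_heis_xi (i : 'I_n) :
  measurable_fun setT (fun xi : H => xi.1.1 ord0 i).
Proof. exact: measurableT_comp (measurable_rV_coord i) measurable_heis_x. Qed.

Lemma measurable_heis_yi (i : 'I_n) :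
  measurable_fun setT (fun xi : H => xi.1.2 ord0 i).
Proof. exact: measurableT_comp (measurable_rV_coord i) measurable_heis_y. Qed.

Definition grid_itv (k : nat) (m : int) (y : R) : bool :=
  m%:~R <= k%:R * y < m%:~R + 1.

(** The half-open cubes of the grid of mesh [1 / k], numbered by the integer
    coordinates of their corner. *)
Definition heis_cell (k : nat)
    (c : {ffun 'I_n -> int} * {ffun 'I_n -> int} * int) : set H :=
  [set xi : H | [/\ forall i, grid_itv k (c.1.1 i) (xi.1.1 ord0 i),
                    forall i, grid_itv k (c.1.2 i) (xi.1.2 ord0 i) &
                    grid_itv k c.2 xi.2]].

Lemma measurable_heis_cell k c : measurable (heis_cell k c).
Proof.
have mcell (m : int) (phi : H -> R) : measurable_fun setT phi ->
    measurable [set xi : H | grid_itv k m (phi xi)].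
  move=> mphi.
  rewrite (_ : [set _ | _] = [set xi : H | m%:~R <= k%:R * phi xi] `&`
    [set xi : H | k%:R * phi xi < m%:~R + 1]).
    have mk : measurable_fun setT (fun xi => k%:R * phi xi).
      exact: measurable_funM.
    apply: measurableI; first exact: measurable_ler_set.
    exact: measurable_ltr_set.
  by apply/seteqP; split => xi; rewrite /grid_itv/= => /andP.
rewrite (_ : heis_cell k c =
    (\bigcap_(i in [set: 'I_n])
      [set xi : H | grid_itv k (c.1.1 i) (xi.1.1 ord0 i)]) `&`
    (\bigcap_(i in [set: 'I_n])
      [set xi : H | grid_itv k (c.1.2 i) (xi.1.2 ord0 i)]) `&`
    [set xi : H | grid_itv k c.2 xi.2]).
  apply: measurableI; last by apply: mcell; exact: measurable_snd.
  apply: measurableI; apply: fin_bigcap_measurable => // i _; apply: mcell.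
    exact: measurable_heis_xi.
  exact: measurable_heis_yi.
apply/seteqP; split => xi /=.
  by move=> [h1 h2 h3]; split=> //; split => i _; [exact: h1|exact: h2].
by move=> [[h1 h2] h3]; split => // i; [exact: h1|exact: h2].
Qed.

(** The topology is the product topology, with balls for the sup norm, so every
    point of an open set lies in a grid cube contained in that set, and there
    are countably many grid cubes. *)
Lemma open_measurable_heis (U : set (heis R n)) :
  open U -> measurable (U : set H).
Proof.
move=> oU.
pose F (j : nat * ({ffun 'I_n -> int} * {ffun 'I_n -> int} * int)) : set H :=
  if `[< heis_cell j.1.+1 j.2 `<=` U >] then heis_cell j.1.+1 j.2 else set0.
rewrite (_ : (U : set H) = \bigcup_j F j).
  apply: countable_bigcupT_measurable => // j; rewrite /F; case: ifPn => // _.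
  exact: measurable_heis_cell.
apply/seteqP; split => xi; last first.
  by move=> [j _]; rewrite /F; case: ifPn => [/asboolP|_ //]; exact.
move=> Uxi.
have [e /= e0 he] := (nbhs_ballP _ _).1 (open_nbhs_nbhs (conj oU Uxi)).
have [k] := ltr_add_invr e0; rewrite add0r => ke.
pose c := ([ffun i => Num.floor (k.+1%:R * xi.1.1 ord0 i)],
   [ffun i => Num.floor (k.+1%:R * xi.1.2 ord0 i)], Num.floor (k.+1%:R * xi.2)).
have fl (y : R) : (Num.floor y)%:~R <= y < (Num.floor y)%:~R + 1.
  by rewrite -intrD1 floor_itv.
have cxi : heis_cell k.+1 c xi.
  by split => [i|i|]; rewrite /grid_itv/= ?ffunE fl.
exists (k, c) => //; rewrite /F ifT//; apply/asboolP => xi' [/= h1 h2 h3].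
have [g1 g2 g3] := cxi.
have close (m : int) (y y' : R) :
    grid_itv k.+1 m y -> grid_itv k.+1 m y' -> ball y e y'.
  move=> /andP[a1 a2] /andP[b1 b2]; apply: lt_trans ke.
  have k0 : 0 < k.+1%:R :> R by [].
  rewrite -(ltr_pM2l k0) divff ?gt_eqF// -{1}(gtr0_norm k0) -normrM.
  by rewrite ltr_norml mulrBr; lra.
apply: he; split; last exact: close g3 h3.
split; split => // i j; rewrite ord1; first exact: close (g1 j) (h1 j).
exact: close (g2 j) (h2 j).
Qed.

(** The sigma-algebra in use is generated by the coordinates, so that
    measurability of continuous functions has to be deduced from
    [open_measurable_heis]. *)
Lemma continuous_measurable_heis (f : heis R n -> R) :
  continuous f -> measurable_fun setT (f : H -> R).
Proof.
move=> cf; apply: (measurability _ (RGenOpens.measurableE R)).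
move=> _ [_ [a [b ->] <-]]; rewrite setTI.
apply: open_measurable_heis; apply: open_comp => // x _; exact: cf.
Qed.

End heis_measurable.

(** * Translations of the Heisenberg group *)

Section heis_translation.
Context {R : realType} {n : nat}.
Local Notation H := (mheis R n).
Local Notation mu := (heis_measure R n).

(** Left and right translations are both of this form, with [c] affine. *)
Lemma measure_preserving_shear (w : 'rV[R]_n * 'rV[R]_n)
    (c : 'rV[R]_n * 'rV[R]_n -> R) :
  measurable_fun setT c ->
  measure_preserving mu (fun xi : H => (w + xi.1, c xi.1 + xi.2) : H).
Proof.
move=> mc.
have mw : measure_preserving (lebesgue_rV2 R n) (fun z => w + z).
  exact: (measure_preserving_skew (measure_preserving_rV_addl w.1)
    (fun=> measure_preserving_rV_addl w.2)
    (measurableT_comp (measurable_rV_addl w.2) measurable_snd)).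
apply: (measure_preserving_skew mw (fun z => measure_preserving_addl (c z))).
by apply: measurable_funD => //; exact: measurableT_comp.
Qed.

Lemma heis_mulE (xi eta : heis R n) : heis_mul xi eta =
  (xi.1 + eta.1,
   xi.2 + eta.2 + 2 * dotv xi.1.2 eta.1.1 - 2 * dotv xi.1.1 eta.1.2).
Proof. by []. Qed.

Lemma measure_preserving_heis_mull (xi : H) :
  measure_preserving mu (fun eta : H => heis_mul xi eta : H).
Proof.
have mc : measurable_fun setT (fun z : 'rV[R]_n * 'rV[R]_n =>
    xi.2 + 2 * dotv xi.1.2 z.1 - 2 * dotv xi.1.1 z.2 : R).
  apply: measurable_funB.
    apply: measurable_funD => //; apply: measurable_funM => //.
    exact: measurable_fun_dotv.
  by apply: measurable_funM => //; exact: measurable_fun_dotv.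
have := measure_preserving_shear xi.1 mc; congr measure_preserving.
by apply/funext => eta; rewrite heis_mulE; congr pair; rewrite /=; ring.
Qed.

Lemma measure_preserving_heis_mulr (eta : H) :
  measure_preserving mu (fun xi : H => heis_mul xi eta : H).
Proof.
have mc : measurable_fun setT (fun z : 'rV[R]_n * 'rV[R]_n =>
    eta.2 + 2 * dotv z.2 eta.1.1 - 2 * dotv z.1 eta.1.2 : R).
  apply: measurable_funB.
    apply: measurable_funD => //; apply: measurable_funM => //.
    exact: measurable_fun_dotv.
  by apply: measurable_funM => //; exact: measurable_fun_dotv.
have := measure_preserving_shear eta.1 mc; congr measure_preserving.
by apply/funext => xi; rewrite heis_mulE addrC; congr pair; rewrite /=; ring.
Qed.

Lemma measurable_fun_heis_mul d (T : measurableType d) (f g : T -> H) :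
  measurable_fun setT f -> measurable_fun setT g ->
  measurable_fun setT (fun x => heis_mul (f x) (g x) : H).
Proof.
move=> mf mg.
have mfx := measurableT_comp measurable_heis_x mf.
have mfy := measurableT_comp measurable_heis_y mf.
have mgx := measurableT_comp measurable_heis_x mg.
have mgy := measurableT_comp measurable_heis_y mg.
apply: measurable_fun_pair; first apply: measurable_fun_pair.
- apply/measurable_fun_rVP => i; under eq_fun do rewrite mxE.
  apply: measurable_funD; first exact: (measurable_fun_rVP _).1 mfx i.
  exact: (measurable_fun_rVP _).1 mgx i.
- apply/measurable_fun_rVP => i; under eq_fun do rewrite mxE.
  apply: measurable_funD; first exact: (measurable_fun_rVP _).1 mfy i.
  exact: (measurable_fun_rVP _).1 mgy i.
apply: measurable_funB.
  apply: measurable_funD.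
    by apply: measurable_funD; exact: (measurableT_comp measurable_snd).
  by apply: measurable_funM => //; exact: measurable_fun_dotv.
by apply: measurable_funM => //; exact: measurable_fun_dotv.
Qed.

Lemma dotvNl (u v : 'rV[R]_n) : dotv (- u) v = - dotv u v.
Proof. by rewrite /dotv -sumrN; apply: eq_bigr => i _; rewrite mxE mulNr. Qed.

Lemma dotvDr (u v w : 'rV[R]_n) : dotv u (v + w) = dotv u v + dotv u w.
Proof.
by rewrite /dotv -big_split/=; apply: eq_bigr => i _; rewrite mxE mulrDr.
Qed.

Lemma dotvC (u v : 'rV[R]_n) : dotv u v = dotv v u.
Proof. by apply: eq_bigr => i _; rewrite mulrC. Qed.

Lemma heis_mulKl (xi eta : heis R n) :
  heis_mul (heis_inv xi) (heis_mul xi eta) = eta.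
Proof.
case: xi eta => [[x y] t] [[x' y'] t']; rewrite /heis_mul /heis_inv/=.
rewrite !dotvNl !dotvDr (dotvC y x).
by rewrite !addKr; congr (_, _); ring.
Qed.

Lemma heis_mulKr (xi eta : heis R n) :
  heis_mul xi (heis_mul (heis_inv xi) eta) = eta.
Proof.
case: xi eta => [[x y] t] [[x' y'] t']; rewrite /heis_mul /heis_inv/=.
rewrite !dotvNl !dotvDr (dotvC _ (- x)) (dotvC _ (- y)) !dotvNl (dotvC y x).
by rewrite !addrA !subrr !add0r; congr (_, _); ring.
Qed.

(** Such an [f] is bounded and vanishes outside a coordinate box, which has
    finite measure.  The finiteness permits a cancellation in
    [hardy_translation]. *)
Lemma Cc_Lp_fin_num (p : R) (f : heis R n -> R) : 0 < p ->
  continuous f -> compact (closure [set xi | f xi != 0]) ->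
  (\int[mu]_xi (`|f xi| `^ p)%:E < +oo)%E.
Proof.
move=> p0 cf cpt.
have mf := continuous_measurable_heis cf.
have [L L0 fL] : exists2 L, 0 < L & forall xi, `|f xi| <= L.
  have := compact_bounded (continuous_compact (continuous_subspaceT cf) cpt).
  move=> /ex_strict_bound_gt0[L L0 hL]; exists L => // xi.
  have [->|fxi] := eqVneq (f xi) 0; first by rewrite normr0 ltW.
  by apply/ltW/hL; exists xi => //; exact: subset_closure.
have [M M0 hM] := ex_strict_bound_gt0 (compact_bounded cpt).
pose B : set H := (rV_box M `*` rV_box M) `*` `[- M, M]%classic.
have mB : measurable B.
  by apply: measurableX => //; apply: measurableX; exact: measurable_rV_box.
have fB xi : f xi != 0 -> B xi.
  move=> /(@subset_closure _ [set xi | f xi != 0])/hM/=.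
  rewrite -[X in X < _]normrN -[X in `|X| < _]add0r.
  have : ball (0 : heis R n) M xi -> B xi.
    move=> [[[_ h1] [_ h2]] h3].
    have e0 (y : R) : ball 0 M y -> `|y| <= M.
      by rewrite /ball/= sub0r normrN => /ltW.
    split; last by rewrite /= in_itv/= -ler_norml; exact: e0.
    split=> i; apply: e0; [have := h1 ord0 i|have := h2 ord0 i]; by rewrite mxE.
  (* A ball of the norm is a product of balls in the coordinates. *)
  by rewrite prod_norm_ball.
apply: (@le_lt_trans _ _ (\int[mu]_(xi in B) (L `^ p)%:E)%E).
  rewrite [leLHS](_ : _ = \int[mu]_(xi in B) (`|f xi| `^ p)%:E)%E.
    apply: ge0_le_subset_integral => // xi _; rewrite lee_fin ?powR_ge0//.
    by apply: (ge0_ler_powR (ltW p0)); rewrite ?nnegrE// ltW.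
  rewrite [RHS]integral_mkcond; apply: eq_integral => xi _; rewrite /patch.
  case: ifPn => // /negP; rewrite inE => nB.
  have [->|/fB//] := eqVneq (f xi) 0.
  by rewrite normr0 powR0 ?gt_eqF.
rewrite integral_cst//= /heis_measure product_measure1E//; last first.
  by apply: measurableX; exact: measurable_rV_box.
rewrite /lebesgue_rV2 [X in (_ * (X * _))%E]product_measure1E;
  [|exact: measurable_rV_box..].
rewrite [X in (X * _ * _)%E]lebesgue_rV_box ?(ltW M0)//.
rewrite [X in (_ * X * _)%E]lebesgue_rV_box ?(ltW M0)//.
rewrite [X in (_ * (_ * X))%E](lebesgue_measure_itv `[- M, M]) /= lte_fin.
by case: ifP => _; rewrite -?EFinB -!EFinM ltry.
Qed.

End heis_translation.

(** * Integration over a cone in the direction of the first coordinate *)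

Section slices.
Context {R : realType}.

Lemma measurable_in_rV_box d (T : measurableType d) n (f : T -> R)
    (v : T -> 'rV[R]_n) :
  measurable_fun setT f -> measurable_fun setT v ->
  measurable [set u | rV_box (f u) (v u)].
Proof.
move=> mf mv.
rewrite [X in measurable X](_ : _ =
    \bigcap_(i in [set: 'I_n]) [set u | `|v u ord0 i| <= f u]).
  apply: fin_bigcap_measurable => // i _; apply: measurable_ler_set => //.
  apply: (measurableT_comp (@normr_measurable R setT)).
  exact: (measurable_fun_rVP _).1 mv i.
by apply/seteqP; split => u /= h; [move=> i _|move=> i]; exact: h.
Qed.

Definition rV_cone k : set 'rV[R]_k.+1 :=
  [set v : 'rV[R]_k.+1 | 0 < v ord0 ord0 /\ rV_box (v ord0 ord0) v].

Lemma integral_rV_cone k (g : R -> R) :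
  measurable_fun setT g -> (forall h, 0 <= g h) ->
  (\int[lebesgue_rV R k.+1]_v (g (v ord0 ord0) * \1_(@rV_cone k) v)%:E =
   \int[lebesgue_measure]_(h in `]0%R, +oo[) (g h * (2 * h) ^+ k)%:E)%E.
Proof.
move=> mg g0; set C := @rV_cone k.
have mC : measurable C.
  apply: measurableI.
    by apply: measurable_ltr_set => //; exact: measurable_rV_coord.
  apply: measurable_in_rV_box (@measurable_id _ _ setT).
  exact: measurable_rV_coord.
have mcC : measurable (@rV_cons R k @^-1` C).
  by rewrite -[X in measurable X]setTI; exact: measurable_rV_cons.
transitivity (\int[lebesgue_measure \x lebesgue_rV R k]_u
    (g u.1 * \1_(@rV_cons R k @^-1` C) u)%:E)%E.
  have mG : measurable_fun setT
      (fun v : 'rV[R]_k.+1 => (g (v ord0 ord0) * \1_C v)%:E).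
    apply/measurable_EFinP; apply: measurable_funM.
      exact: (measurableT_comp mg (measurable_rV_coord ord0)).
    exact: measurable_indic.
  rewrite [LHS](@ge0_integral_pushforward _ _ _ _ R _ (@measurable_rV_cons R k)
    (lebesgue_measure \x lebesgue_rV R k)%E setT _ measurableT mG); last first.
    by move=> v _; rewrite lee_fin mulr_ge0.
  by rewrite preimage_setT; apply: eq_integral => u _ /=; rewrite rV_cons0.
rewrite (integral_slice _ _ mcC mg g0) [RHS]integral_mkcond.
apply: eq_integral => h _; rewrite /patch mem_setE in_itv/= andbT.
case: ifPn => h0.
  rewrite EFinM; congr (_ * _)%E.
  rewrite -(lebesgue_rV_box k (ltW h0)); congr (lebesgue_rV R k _).
  apply/seteqP; split => v; rewrite /xsection/= inE /C /rV_cone/= rV_cons0/=.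
    by move=> [_ hv] i; have := hv (lift ord0 i); rewrite rV_consS.
  move=> hv; split=> // i; case: (unliftP ord0 i) => [j|] ->.
    by rewrite rV_consS; exact: hv.
  by rewrite rV_cons0 gtr0_norm.
rewrite (_ : xsection _ _ = set0) ?measure0 ?mule0//.
rewrite -subset0 => v; rewrite /xsection/= inE /C /rV_cone/= rV_cons0/=.
by move=> [h1]; rewrite h1 in h0.
Qed.

(** On this set [x1] controls all coordinates as homogeneity dictates, so that
    the kernel is comparable to a power of [x1]; and its slice at height
    [x1 = h] has measure [2 ^+ (2 * n) * h ^+ (2 * n + 1)]. *)
Definition heis_cone n (hn : (0 < n)%N) :
    set (mheis R n) :=
  [set eta | [/\ 0 < x1 hn eta, rV_box (x1 hn eta) eta.1.1,
                 rV_box (x1 hn eta) eta.1.2 & `|eta.2| <= x1 hn eta ^+ 2]].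

Lemma measurable_x1 n (hn : (0 < n)%N) :
  measurable_fun setT (x1 hn : mheis R n -> R).
Proof. exact: measurable_heis_xi. Qed.

Lemma measurable_heis_cone n (hn : (0 < n)%N) : measurable (heis_cone hn).
Proof.
have mx := measurable_x1 hn.
rewrite (_ : heis_cone hn = [set eta | 0 < x1 hn eta] `&`
  [set eta | rV_box (x1 hn eta) eta.1.1] `&`
  [set eta | rV_box (x1 hn eta) eta.1.2] `&`
  [set eta | `|eta.2| <= x1 hn eta ^+ 2]); last first.
  by apply/seteqP; split => eta /=; [move=> [a b c e]|move=> [[[a b] c] e]].
apply: measurableI; last first.
  apply: measurable_ler_set; last exact: measurable_funX.
  exact: (measurableT_comp (@normr_measurable R setT) measurable_snd).
apply: measurableI; last exact: measurable_in_rV_box mx measurable_heis_y.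
apply: measurableI; last exact: measurable_in_rV_box mx measurable_heis_x.
exact: measurable_ltr_set.
Qed.

(** Slicing off [t] (length [2 * h ^+ 2]), then [y] (volume [(2 * h) ^+ n]),
    then all coordinates of [x] but the first (volume [(2 * h) ^+ (n - 1)]). *)
Lemma integral_heis_cone n (hn : (0 < n)%N) (g : R -> R) :
  measurable_fun setT g -> (forall h, 0 <= g h) ->
  (\int[heis_measure R n]_eta (g (x1 hn eta) * \1_(heis_cone hn) eta)%:E =
   \int[lebesgue_measure]_(h in `]0%R, +oo[)
     (g h * (2 ^+ (2 * n) * h ^+ (2 * n + 1)))%:E)%E.
Proof.
case: n hn => // k hn mg g0.
have x1E (z : 'rV[R]_k.+1 * 'rV[R]_k.+1) t : x1 hn (z, t) = z.1 ord0 ord0.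
  by rewrite /x1/=; congr (z.1 _ _); apply/val_inj.
pose a (z : 'rV[R]_k.+1 * 'rV[R]_k.+1) := z.1 ord0 ord0.
have ma : measurable_fun setT a.
  exact: (measurableT_comp (measurable_rV_coord ord0) measurable_fst).
transitivity (\int[lebesgue_rV2 R k.+1 \x lebesgue_measure]_u
    (((g \o a) u.1) * \1_(heis_cone hn) u)%:E)%E.
  by apply: eq_integral => -[z t] _; rewrite x1E.
have mga : measurable_fun setT (g \o a) by exact: measurableT_comp mg ma.
rewrite (integral_slice _ _ (measurable_heis_cone hn) mga)//; last first.
  by move=> z; exact: g0.
pose B : set ('rV[R]_k.+1 * 'rV[R]_k.+1) :=
  [set z | [/\ 0 < a z, rV_box (a z) z.1 & rV_box (a z) z.2]].
have mB : measurable B.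
  rewrite (_ : B = [set z | 0 < a z] `&` [set z | rV_box (a z) z.1] `&`
    [set z | rV_box (a z) z.2]).
    apply: measurableI; last exact: measurable_in_rV_box ma measurable_snd.
    apply: measurableI; last exact: measurable_in_rV_box ma measurable_fst.
    exact: measurable_ltr_set.
  by apply/seteqP; split => z /=; [move=> [b c e]|move=> [[b c] e]].
pose g1 (h : R) := g h * (2 * h ^+ 2).
have mg1 : measurable_fun setT g1.
  by apply: measurable_funM => //; exact: measurable_funM.
have g10 h : 0 <= g1 h by rewrite mulr_ge0// mulr_ge0// sqr_ge0.
transitivity (\int[lebesgue_rV R k.+1 \x lebesgue_rV R k.+1]_z
    ((g1 \o (fun v : 'rV[R]_k.+1 => v ord0 ord0)) z.1 * \1_B z)%:E)%E.
  apply: eq_integral => z _ /=; rewrite -/(a z) /g1 -mulrA EFinM.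
  congr (_ * _)%E.
  have [Bz|nBz] := pselect (B z).
    rewrite indicE mem_set// mulr1.
    rewrite [X in lebesgue_measure X](_ : _ =
        `[- (a z ^+ 2), a z ^+ 2]%classic).
      rewrite lebesgue_measure_itv/= lte_fin.
      have [b _ _] := Bz; have := exprn_gt0 2 b => b2.
      by rewrite ifT ?gtrN// -EFinB opprK; congr EFin; ring.
    apply/seteqP; split => t;
      rewrite /xsection/= inE /heis_cone/= in_itv/= -ler_norml.
      by case; rewrite x1E.
    by move=> ht; have [] := Bz; split; rewrite ?x1E.
  rewrite indicE memNset// mulr0 (_ : xsection _ _ = set0) ?measure0//.
  rewrite -subset0 => t; rewrite /xsection/= inE /heis_cone/= x1E => -[b c e _].
  by apply: nBz.
have mg1v : measurable_fun setT (g1 \o (fun v : 'rV[R]_k.+1 => v ord0 ord0)).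
  exact: measurableT_comp mg1 (measurable_rV_coord _).
rewrite (integral_slice _ _ mB mg1v)//; last by move=> v; exact: g10.
(* The absolute value keeps [g2] nonnegative at negative heights. *)
pose g2 (h : R) := g1 h * `|2 * h| ^+ k.+1.
have mg2 : measurable_fun setT g2.
  apply: measurable_funM => //; apply: measurable_funX.
  by apply: measurableT_comp => //; exact: measurable_funM.
have g20 h : 0 <= g2 h by rewrite mulr_ge0// exprn_ge0.
transitivity (\int[lebesgue_rV R k.+1]_v
     (g2 (v ord0 ord0) * \1_(@rV_cone k) v)%:E)%E.
  apply: eq_integral => v _; rewrite /g2 /comp -mulrA [RHS]EFinM.
  congr (_ * _)%E.
  have [Dv|nDv] := pselect (@rV_cone k v).
    have [v0 vb] := Dv.
    rewrite indicE mem_set// mulr1 ger0_norm ?mulr_ge0 ?(ltW v0)//.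
    rewrite -(lebesgue_rV_box k.+1 (ltW v0)); congr (lebesgue_rV R k.+1 _).
    apply/seteqP; split => w; rewrite /xsection/= inE /B/= /a/=; first by case.
    by move=> hw; split.
  rewrite indicE memNset// mulr0 (_ : xsection _ _ = set0) ?measure0//.
  rewrite -subset0 => w; rewrite /xsection/= inE /B/= /a/= => -[b c _].
  by apply: nDv.
rewrite integral_rV_cone//; apply: eq_integral => h.
rewrite inE/= in_itv/= andbT => h0; congr EFin.
rewrite /g2 /g1 ger0_norm ?mulr_ge0 ?(ltW h0)// -!mulrA; congr (_ * _).
rewrite !exprMn (_ : (2 * k.+1 = 1 + k.+1 + k)%N); last first.
  by rewrite mul2n -addnn add1n [in RHS]addSnnS.
rewrite !exprD !expr1; ring.
Qed.

End slices.

(** * The Hardy inequality for one translation *)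

Section hardy.
Context {R : realType} {n : nat} (hn : (0 < n)%N).
Local Notation H := (mheis R n).
Local Notation mu := (heis_measure R n).

Lemma x1_heis_mul (xi eta : heis R n) :
  x1 hn (heis_mul xi eta) = x1 hn xi + x1 hn eta.
Proof. by rewrite /x1/= mxE. Qed.

(** A Hardy inequality with a finite difference in place of a derivative.  Its
    left-hand side depends on [eta] only through [x1 hn eta], so it applies to
    all [eta] of a slice of the cone at once.

    Let [h = x1 hn eta], and let [u] be the weight.  At every point
    [powR_quotient_le] bounds the odds of [u] at [xi o eta], to the power
    [p - 1] and times [|f (xi o eta)| `^ p], by
    [|f xi - f (xi o eta)| `^ p + u `^ (p - 1) * |f xi| `^ p].  Integration and
    right invariance of the measure bring the left-hand side back to [xi], where
    it exceeds [(u `^ (p - 1) + (p - 1) * u `^ p) * |f xi| `^ p]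
    by [powR_odds_ge]; the integral of [u `^ (p - 1) * |f xi| `^ p] cancels. *)
Lemma hardy_translation (p : R) (f : heis R n -> R) (eta : heis R n) :
  1 < p -> measurable_fun setT (f : H -> R) ->
  (\int[mu]_xi (`|f xi| `^ p)%:E < +oo)%E ->
  (forall xi, x1 hn xi <= 0 -> f xi = 0) -> 0 < x1 hn eta ->
  (\int[mu]_xi
     ((p - 1) * hardy_weight (x1 hn eta) (x1 hn xi) `^ p * `|f xi| `^ p)%:E <=
   \int[mu]_xi (`|f xi - f (heis_mul xi eta)| `^ p)%:E)%E.
Proof.
move=> p1 mf fp f0 h0; set h := x1 hn eta.
have p0 : 0 < p by rewrite (lt_trans _ p1).
have p10 : 0 <= p - 1 by rewrite subr_ge0 ltW.
pose u (xi : H) := hardy_weight h (x1 hn xi).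
have mx : measurable_fun setT (x1 hn : H -> R) by exact: measurable_x1.
have mw : measurable_fun setT u by exact: measurable_hardy_weight.
have mfp : measurable_fun setT (fun xi : H => `|f xi| `^ p).
  by apply: measurable_powR_comp; exact: measurableT_comp.
pose F0 (xi : H) := (((p - 1) * u xi `^ p) * `|f xi| `^ p)%:E.
pose F1 (xi : H) := (u xi `^ (p - 1) * `|f xi| `^ p)%:E.
pose F2 (xi : H) := ((u xi / (1 - u xi)) `^ (p - 1) * `|f xi| `^ p)%:E.
pose G (xi : H) := (`|f xi - f (heis_mul xi eta)| `^ p)%:E.
have mF0 : measurable_fun setT F0.
  apply/measurable_EFinP; apply: measurable_funM => //.
  by apply: measurable_funM => //; exact: measurable_powR_comp.
have mF1 : measurable_fun setT F1.
  apply/measurable_EFinP; apply: measurable_funM => //.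
  exact: measurable_powR_comp.
have mF2 : measurable_fun setT F2.
  apply/measurable_EFinP; apply: measurable_funM => //.
  apply: measurable_powR_comp; apply: measurable_funM => //.
  by apply: measurable_fun_invr; exact: measurable_funB.
have [mtr _] := measure_preserving_heis_mulr eta.
have mG : measurable_fun setT G.
  apply/measurable_EFinP; apply: measurable_powR_comp.
  apply: measurableT_comp => //; apply: measurable_funB => //.
  exact: (measurableT_comp mf mtr).
have F00 xi : (0 <= F0 xi)%E by rewrite lee_fin !mulr_ge0// powR_ge0.
have F10 xi : (0 <= F1 xi)%E by rewrite lee_fin !mulr_ge0// powR_ge0.
have F20 xi : (0 <= F2 xi)%E by rewrite lee_fin !mulr_ge0// powR_ge0.
have G0 xi : (0 <= G xi)%E by rewrite lee_fin powR_ge0.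
have zero xi : x1 hn xi <= 0 -> `|f xi| `^ p = 0.
  by move=> /f0 ->; rewrite normr0 powR0// gt_eqF.
(* u < 1 on the half-space, so F1 is below the integrable |f| `^ p. *)
have F1fin : (\int[mu]_xi F1 xi)%E \is a fin_num.
  rewrite ge0_fin_numE; last exact: integral_ge0.
  apply: le_lt_trans fp; apply: ge0_le_subset_integral => // xi _.
  rewrite lee_fin; have [x0|/zero ->] := ltP 0 (x1 hn xi).
    have [u0 u1] := hardy_weight_itv h0 x0.
    rewrite ler_piMl ?powR_ge0//.
    have := @ge0_ler_powR _ _ p10 (u xi) 1.
    by rewrite powR1 !nnegrE; apply => //; exact: ltW.
  by rewrite mulr0.
have lower : (\int[mu]_xi F1 xi + \int[mu]_xi F0 xi <= \int[mu]_xi F2 xi)%E.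
  rewrite -ge0_integralD//; apply: ge0_le_subset_integral => // xi _.
    by rewrite adde_ge0.
  rewrite -EFinD lee_fin -mulrDl.
  have [x0|/zero ->] := ltP 0 (x1 hn xi); last by rewrite !mulr0.
  have [u0 u1] := hardy_weight_itv h0 x0.
  by apply: (ler_wpM2r (powR_ge0 _ _)); exact: powR_odds_ge.
have upper : (\int[mu]_xi F2 xi <= \int[mu]_xi G xi + \int[mu]_xi F1 xi)%E.
  rewrite -(measure_preserving_integral
    (measure_preserving_heis_mulr eta) mF2 F20).
  rewrite -ge0_integralD//; apply: ge0_le_subset_integral => // xi _.
    by rewrite adde_ge0.
  rewrite -EFinD lee_fin.
  have [y0|/zero ->] := ltP 0 (x1 hn (heis_mul xi eta)); last first.
    by rewrite mulr0 addr_ge0 ?mulr_ge0 ?powR_ge0.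
  have uE : u xi = h / (2 * x1 hn (heis_mul xi eta)).
    by rewrite /u /hardy_weight x1_heis_mul.
  have q0 : 0 < u xi by rewrite uE divr_gt0// mulr_gt0.
  have -> : u (heis_mul xi eta) / (1 - u (heis_mul xi eta)) = u xi / (1 + u xi).
    rewrite uE /u /hardy_weight; field.
    rewrite -/h; move: y0 h0; rewrite -/h; set y := x1 hn _ => y0 h0.
    by rewrite !gt_eqF//; lra.
  by rewrite distrC powR_quotient_le.
rewrite -(leeD2lE _ _ F1fin).
by apply: (le_trans lower); rewrite addeC.
Qed.

End hardy.

(** * The kernel on the cone *)

Section kernel_on_cone.
Context {R : realType} {n : nat} (hn : (0 < n)%N).
Local Notation H := (mheis R n).

Lemma dotv_ge0 (v : 'rV[R]_n) : 0 <= dotv v v.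
Proof. by apply: sumr_ge0 => i _; rewrite -expr2 sqr_ge0. Qed.

Lemma eucl_norm_ge0 (z : 'rV[R]_n * 'rV[R]_n) : 0 <= eucl_norm z.
Proof. exact: sqrtr_ge0. Qed.

Lemma eucl_normN (z : 'rV[R]_n * 'rV[R]_n) : eucl_norm (- z) = eucl_norm z.
Proof.
by rewrite /eucl_norm /dotv; congr (Num.sqrt (_ + _));
  apply: eq_bigr => i _; rewrite !mxE mulrNN.
Qed.

Lemma eucl_norm_sqr (z : 'rV[R]_n * 'rV[R]_n) :
  eucl_norm z ^+ 2 = dotv z.1 z.1 + dotv z.2 z.2.
Proof. by rewrite sqr_sqrtr// addr_ge0// dotv_ge0. Qed.

Lemma dotv_rV_box (h : R) (v : 'rV[R]_n) :
  rV_box h v -> dotv v v <= n%:R * h ^+ 2.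
Proof.
move=> hv; rewrite (le_trans (ler_sum _ (_ : forall i, _ -> _ <= h ^+ 2)))//.
  move=> i _; rewrite -expr2 -(real_normK (num_real (v _ _))).
  by rewrite lerXn2r// ?nnegrE// (le_trans _ (hv i)).
by rewrite sumr_const card_ord mulr_natl.
Qed.

Lemma eucl_norm_cone (eta : H) : heis_cone hn eta ->
  0 < eucl_norm eta.1 <= (2 * n%:R) * x1 hn eta.
Proof.
move=> [h0 hx hy _]; set h := x1 hn eta.
have n1 : 1 <= n%:R :> R by rewrite ler1n.
apply/andP; split.
  rewrite lt_def eucl_norm_ge0 andbT; apply/negP => /eqP e0.
  have := eucl_norm_sqr eta.1; rewrite e0 expr0n/= => /esym/eqP.
  rewrite paddr_eq0 ?dotv_ge0// => /andP[+ _].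
  rewrite /dotv psumr_eq0; last by move=> i _; rewrite -expr2 sqr_ge0.
  move=> /allP/(_ (Ordinal hn)); rewrite mem_index_enum => /(_ isT)/=.
  by rewrite mulf_eq0 orbb => /eqP hh; move: h0; rewrite /x1 hh ltxx.
rewrite -(@ler_pXn2r _ 2)// ?nnegrE ?eucl_norm_ge0 ?mulr_ge0 ?(ltW h0)//.
rewrite eucl_norm_sqr (le_trans (lerD (dotv_rV_box hx) (dotv_rV_box hy)))//.
rewrite -/h -mulrDl exprMn ler_wpM2r ?sqr_ge0//.
by rewrite exprMn; nra.
Qed.

Lemma heis_norm_cone (eta : H) : heis_cone hn eta ->
  0 < heis_norm eta <= (2 * n%:R + 1) * x1 hn eta.
Proof.
move=> ceta; have /andP[e0 eh] := eucl_norm_cone ceta.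
have [h0 _ _ ht] := ceta; set h := x1 hn eta in h0 eh ht *.
have n0 : 0 <= n%:R :> R by [].
have e4 : 0 < eucl_norm eta.1 ^+ 4 by rewrite exprn_gt0.
apply/andP; split; first by rewrite powR_gt0// ltr_pwDl// sqr_ge0.
have N0 : 0 <= (2 * n%:R + 1) * h.
  by rewrite mulr_ge0 ?addr_ge0 ?mulr_ge0 ?(ltW h0).
have -> : (2 * n%:R + 1) * h = (((2 * n%:R + 1) * h) ^+ 4) `^ (4^-1).
  by rewrite -powR_mulrn// -powRrM divff// powRr1.
apply: ge0_ler_powR; rewrite ?nnegrE ?exprn_ge0//.
  by rewrite addr_ge0 ?sqr_ge0// ltW.
have h4 : 0 <= h ^+ 4 by rewrite exprn_ge0// ltW.
have : eucl_norm eta.1 ^+ 4 <= (2 * n%:R * h) ^+ 4.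
  by rewrite lerXn2r// nnegrE ?(ltW e0)// mulr_ge0 ?mulr_ge0// ltW.
have : eta.2 ^+ 2 <= h ^+ 4.
  rewrite -(real_normK (num_real eta.2)) (_ : 4 = 2 * 2)%N// exprM.
  by rewrite lerXn2r// nnegrE ?sqr_ge0.
rewrite !exprMn => t4 ee.
apply: (le_trans (lerD ee t4)).
rewrite -[X in _ + X]mul1r -mulrDl ler_wpM2r//.
rewrite -exprMn; set a := 2 * n%:R.
have a0 : 0 <= a by rewrite mulr_ge0.
rewrite (_ : (a + 1) ^+ 4 = a ^+ 4 + 1 + (4 * a ^+ 3 + 6 * a ^+ 2 + 4 * a));
  last by ring.
by rewrite lerDl !addr_ge0// mulr_ge0// ?exprn_ge0.
Qed.

Lemma measurable_eucl_norm d (T : measurableType d)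
    (f : T -> 'rV[R]_n * 'rV[R]_n) :
  measurable_fun setT f -> measurable_fun setT (fun u => eucl_norm (f u)).
Proof.
move=> mf; rewrite (_ : (fun u => _) =
    (fun u => (dotv (f u).1 (f u).1 + dotv (f u).2 (f u).2) `^ 2^-1)).
  apply: measurable_powR_comp; apply: measurable_funD;
    apply: measurable_fun_dotv;
    by [exact: (measurableT_comp measurable_fst mf)|
        exact: (measurableT_comp measurable_snd mf)].
by apply/funext => u; rewrite powR12_sqrt// addr_ge0// dotv_ge0.
Qed.

Definition heis_kernel (a b : R) (eta : heis R n) : R :=
  (heis_norm eta `^ a * eucl_norm eta.1 `^ b)^-1.

Lemma heis_kernel_ge0 a b eta : 0 <= heis_kernel a b eta.
Proof. by rewrite invr_ge0 mulr_ge0// powR_ge0. Qed.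

Lemma measurable_heis_kernel a b :
  measurable_fun setT (heis_kernel a b : H -> R).
Proof.
have me : measurable_fun setT (fun eta : H => eucl_norm eta.1).
  exact: measurable_eucl_norm.
apply: measurable_fun_invr; apply: measurable_funM;
  apply: measurable_powR_comp => //.
apply: measurable_powR_comp; apply: measurable_funD; apply: measurable_funX.
  exact: me.
exact: measurable_snd.
Qed.

Lemma heis_kernel_cone a b eta : 0 <= a -> 0 <= b -> heis_cone hn eta ->
  (2 * n%:R + 1) `^ (- (a + b)) * x1 hn eta `^ (- (a + b)) <=
  heis_kernel a b eta.
Proof.
move=> a0 b0 ceta; have [h0 _ _ _] := ceta.
have /andP[d0 dh] := heis_norm_cone ceta.
have /andP[e0 eh] := eucl_norm_cone ceta.
have N0 : 0 < 2 * n%:R + 1 :> R by rewrite ltr_wpDl// mulr_ge0.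
have Nh0 : 0 < (2 * n%:R + 1) * x1 hn eta by rewrite mulr_gt0.
rewrite -powRM ?(ltW N0) ?(ltW h0)// powRN.
have da : 0 < heis_norm eta `^ a by exact: powR_gt0.
have ea : 0 < eucl_norm eta.1 `^ b by exact: powR_gt0.
rewrite lef_pV2 ?posrE ?(powR_gt0 _ Nh0) ?(mulr_gt0 da ea)//.
rewrite powRD ?(gt_eqF Nh0) ?implybT//; apply: ler_pM; rewrite ?powR_ge0//.
  by apply: (ge0_ler_powR a0); rewrite ?nnegrE ?(ltW d0) ?(ltW Nh0).
apply: (ge0_ler_powR b0); rewrite ?nnegrE ?(ltW e0) ?(ltW Nh0)//.
by rewrite (le_trans eh)// ler_wpM2r ?(ltW h0)// lerDl.
Qed.

End kernel_on_cone.

(** * The double integral as an integral over translations *)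

Section double_integral.
Context {R : realType} {n : nat}.
Local Notation H := (mheis R n).
Local Notation mu := (heis_measure R n).

(** Substitute [xi' = xi o eta], which preserves the measure for every fixed
    [xi], and exchange the two integrals. *)
Lemma gagliardo_translation (p a b : R) (f : heis R n -> R) :
  measurable_fun setT (f : H -> R) ->
  (\int[mu]_xi \int[mu]_xi'
     (`|f xi - f xi'| `^ p /
      (heis_norm (heis_mul (heis_inv xi) xi') `^ a *
       eucl_norm (xi.1 - xi'.1) `^ b))%:E =
   \int[mu]_eta \int[mu]_xi
     (heis_kernel a b eta * `|f xi - f (heis_mul xi eta)| `^ p)%:E)%E.
Proof.
move=> mf.
pose K (u : H * H) : \bar R :=
  (heis_kernel a b u.2 * `|f u.1 - f (heis_mul u.1 u.2)| `^ p)%:E.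
have K0 u : (0 <= K u)%E by rewrite lee_fin mulr_ge0 ?heis_kernel_ge0 ?powR_ge0.
have mK : measurable_fun setT K.
  apply/measurable_EFinP; apply: measurable_funM.
    exact: (measurableT_comp (measurable_heis_kernel a b) measurable_snd).
  apply: measurable_powR_comp; apply: measurableT_comp => //.
  apply: measurable_funB; first exact: (measurableT_comp mf measurable_fst).
  apply: (measurableT_comp mf).
  exact: measurable_fun_heis_mul measurable_fst measurable_snd.
transitivity (\int[mu]_xi \int[mu]_eta K (xi, eta))%E; last first.
  exact: (@fubini_tonelli _ _ H H R mu mu K mK K0).
apply: eq_integral => xi _.
pose P (xi' : H) : \bar R := (`|f xi - f xi'| `^ p /
      (heis_norm (heis_mul (heis_inv xi) xi') `^ a *
       eucl_norm (xi.1 - xi'.1) `^ b))%:E.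
have PE xi' : P xi' = K (xi, heis_mul (heis_inv xi) xi').
  have e1 : eucl_norm (xi.1 - xi'.1) =
      eucl_norm (heis_mul (heis_inv xi) xi').1.
    by rewrite -[LHS]eucl_normN opprB addrC.
  by rewrite /P /K /fst /snd (heis_mulKr xi xi') e1 /heis_kernel [in RHS]mulrC.
have mP : measurable_fun setT P.
  rewrite (funext PE); apply: (measurableT_comp mK).
  apply: measurable_fun_pair => //.
  exact: measurable_fun_heis_mul.
rewrite -[LHS](measure_preserving_integral
  (measure_preserving_heis_mull xi) mP).
  apply: eq_integral => eta _; rewrite PE heis_mulKl//.
by move=> xi'; rewrite PE.
Qed.

End double_integral.

(** * The lower bound *)

Section lower_bound.
Context {R : realType} {n : nat} (hn : (0 < n)%N).
Local Notation H := (mheis R n).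
Local Notation mu := (heis_measure R n).
Local Notation N := (2 * n%:R + 1 : R).

(** As a function of [xi], the integrand on the left of the Hardy inequality
    times the lower bound of the kernel on the cone; as a function of [eta], a
    function of [x1] times the indicator of the cone. *)
Definition cone_minorant (p c : R) (f : heis R n -> R)
    (xi eta : heis R n) : R :=
  N `^ (- c) * (p - 1) * `|f xi| `^ p *
  (x1 hn eta `^ (- c) * hardy_weight (x1 hn eta) (x1 hn xi) `^ p) *
  \1_(heis_cone hn : set H) eta.

Lemma cone_minorant_ge0 p c f xi eta : 1 < p -> 0 <= cone_minorant p c f xi eta.
Proof. by move=> p1; rewrite !mulr_ge0 ?powR_ge0// subr_ge0 ltW. Qed.

Lemma measurable_cone_minorant p c (f : heis R n -> R) :
  measurable_fun setT (f : H -> R) ->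
  measurable_fun setT (fun u : H * H => cone_minorant p c f u.1 u.2).
Proof.
move=> mf.
have mx1 := measurableT_comp (@measurable_x1 R n hn) (@measurable_fst _ _ H H).
have mx2 := measurableT_comp (@measurable_x1 R n hn) (@measurable_snd _ _ H H).
have mI : measurable_fun setT (\1_(heis_cone hn) : H -> R).
  by apply: measurable_indic; exact: measurable_heis_cone.
apply: measurable_funM; last exact: (measurableT_comp mI measurable_snd).
apply: measurable_funM.
  apply: measurable_funM => //; apply: measurable_powR_comp.
  by apply: measurableT_comp => //; exact: (measurableT_comp mf measurable_fst).
apply: measurable_funM; first exact: measurable_powR_comp.
by apply: measurable_powR_comp; exact: measurable_hardy_weight.
Qed.

Lemma integral_cone_minorant_le p a b (f : heis R n -> R) (eta : heis R n) :
  1 < p -> 0 <= a -> 0 <= b ->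
  measurable_fun setT (f : H -> R) ->
  (\int[mu]_xi (`|f xi| `^ p)%:E < +oo)%E ->
  (forall xi, x1 hn xi <= 0 -> f xi = 0) ->
  (\int[mu]_xi (cone_minorant p (a + b) f xi eta)%:E <=
   \int[mu]_xi
     (heis_kernel a b eta * `|f xi - f (heis_mul xi eta)| `^ p)%:E)%E.
Proof.
move=> p1 a0 b0 mf fp f0.
have k0 := heis_kernel_ge0 a b eta.
have [ceta|nceta] := pselect ((heis_cone hn : set H) eta); last first.
  under eq_integral do rewrite /cone_minorant indicE memNset// mulr0.
  rewrite integral0; apply: integral_ge0 => xi _.
  by rewrite lee_fin mulr_ge0// powR_ge0.
have [h0 _ _ _] := ceta.
have mx : measurable_fun setT (x1 hn : H -> R) by exact: measurable_x1.
have [mtr _] := measure_preserving_heis_mulr eta.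
have mD : measurable_fun setT
    (fun xi : H => `|f xi - f (heis_mul xi eta)| `^ p).
  apply: measurable_powR_comp; apply: measurableT_comp => //.
  by apply: measurable_funB => //; exact: (measurableT_comp mf mtr).
have mW : measurable_fun setT (fun xi : H =>
    (p - 1) * hardy_weight (x1 hn eta) (x1 hn xi) `^ p * `|f xi| `^ p).
  apply: measurable_funM.
    apply: measurable_funM => //; apply: measurable_powR_comp.
    exact: measurable_hardy_weight.
  by apply: measurable_powR_comp; exact: measurableT_comp.
have W0 (xi : H) :
    0 <= (p - 1) * hardy_weight (x1 hn eta) (x1 hn xi) `^ p * `|f xi| `^ p.
  by rewrite !mulr_ge0 ?powR_ge0// subr_ge0 ltW.
under [leRHS]eq_integral do rewrite EFinM.
rewrite [leRHS]ge0_integralZl//; last exact/measurable_EFinP.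
pose c := N `^ (- (a + b)) * x1 hn eta `^ (- (a + b)).
have c0 : 0 <= c by rewrite mulr_ge0 ?powR_ge0.
rewrite (_ : (fun xi => _) = (fun xi => (c%:E *
    ((p - 1) * hardy_weight (x1 hn eta) (x1 hn xi) `^ p * `|f xi| `^ p)%:E)%E)).
  rewrite ge0_integralZl//; last 2 first.
  - exact/measurable_EFinP.
  - by move=> xi _; rewrite lee_fin.
  apply: lee_pmul.
  - by rewrite lee_fin.
  - by apply: integral_ge0 => xi _; rewrite lee_fin.
  - by rewrite lee_fin; exact: heis_kernel_cone.
  - exact: hardy_translation.
apply/funext => xi; rewrite -EFinM; congr EFin.
rewrite /cone_minorant indicE mem_set// mulr1 /c; ring.
Qed.

(** Integration over the slices of the cone leaves the one-dimensional kernel: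
    with [Q = 2 * n + 2], [h `^ (- (Q + s * p + alpha))] times the volume of a
    slice is proportional to [h `^ (- (s * p + alpha) - 1)]. *)
Lemma integral_cone_minorant_ge p s alpha (f : heis R n -> R) (xi : heis R n) :
  1 < p -> 0 < s -> s < 1 -> 0 <= alpha -> 0 < x1 hn xi ->
  ((N `^ (- ((heis_dim n)%:R + p + alpha)) * (p - 1) * 2 ^+ (2 * n) *
     (4^-1 `^ p / (4 * p)) / ((s + alpha / p) * (1 - s)) *
     (`|f xi| `^ p / x1 hn xi `^ (s * p + alpha)))%:E <=
   \int[mu]_eta
     (cone_minorant p ((heis_dim n)%:R + s * p + alpha) f xi eta)%:E)%E.
Proof.
move=> p1 s0 s1 al0 x0; set x := x1 hn xi.
have p0 : 0 < p by rewrite (lt_trans _ p1).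
set b := s * p + alpha; set c := _ + s * p + alpha.
pose k := N `^ (- c) * (p - 1) * `|f xi| `^ p.
have k0 : 0 <= k by rewrite !mulr_ge0 ?powR_ge0// subr_ge0 ltW.
have mw : measurable_fun setT (fun h : R => hardy_weight h x `^ p).
  by apply: measurable_powR_comp; exact: measurable_hardy_weight.
pose g (h : R) := k * (h `^ (- c) * hardy_weight h x `^ p).
have mg : measurable_fun setT g.
  by apply: measurable_funM => //; exact: measurable_funM.
have g0 h : 0 <= g h by rewrite mulr_ge0// mulr_ge0// powR_ge0.
rewrite [leRHS](_ : _ =
  \int[mu]_eta (g (x1 hn eta) * \1_(heis_cone hn) eta)%:E)%E//.
rewrite integral_heis_cone//.
have kE (h : R) : `]0%R, +oo[%classic h ->
    (g h * (2 ^+ (2 * n) * h ^+ (2 * n + 1)))%:E =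
    ((k * 2 ^+ (2 * n))%:E * (h `^ (- b - 1) * hardy_weight h x `^ p)%:E)%E.
  rewrite /= in_itv/= andbT => h0; rewrite -EFinM; congr EFin.
  rewrite (_ : - b - 1 = - c + (2 * n + 1)%:R).
    rewrite powRD ?(gt_eqF h0) ?implybT// powR_mulrn ?(ltW h0)//.
    by rewrite /g; ring.
  by rewrite /b /c /heis_dim !natrD; ring.
under eq_integral => h /[!inE] hh do rewrite (kE _ hh).
rewrite ge0_integralZl//; last 3 first.
- apply/measurable_EFinP; apply: measurable_funTS; apply: measurable_funM => //.
- by move=> h _; rewrite lee_fin mulr_ge0 ?powR_ge0.
- by rewrite lee_fin mulr_ge0// exprn_ge0.
apply: (@le_trans _ _ ((k * 2 ^+ (2 * n))%:E * (x `^ (- b) *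
   (4^-1 `^ p / (4 * p) / ((s + alpha / p) * (1 - s))))%:E)%E); last first.
  apply: lee_wpmul2l; first by rewrite lee_fin mulr_ge0// exprn_ge0.
  exact: integral_kernel_ge.
rewrite -EFinM lee_fin (powRN x b).
set N0 := N `^ _; set X := x `^ b; set D := (s + alpha / p) * (1 - s).
set M := 4^-1 `^ p / (4 * p).
set T := 2 ^+ (2 * n).
set Z := (p - 1) * `|f xi| `^ p * T * (X^-1 * (M / D)).
rewrite [leLHS](_ : _ = N0 * Z); last by rewrite /Z; ring.
rewrite [leRHS](_ : _ = N `^ (- c) * Z); last by rewrite /Z /k; ring.
have D0 : 0 <= D.
  by rewrite mulr_ge0 ?subr_ge0 ?(ltW s1)// addr_ge0 ?(ltW s0)// divr_ge0// ltW.
apply: ler_wpM2r; rewrite /Z.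
  rewrite !mulr_ge0 ?subr_ge0 ?(ltW p1) ?invr_ge0 ?powR_ge0 ?exprn_ge0//.
  by rewrite mulr_ge0// ltW.
(* s < 1 makes the power of N independent of s. *)
apply: ler_powR; first by rewrite lerDr mulr_ge0.
rewrite lerN2 /c !lerD2r lerD2l.
by rewrite ler_piMl ?ltW.
Qed.

End lower_bound.

(* In the right-hand integrand, the division by zero on the null set z = z' is
   0 by convention. *)
Theorem theorem1p2 (R : realType) (n : nat) (hn : (0 < n)%N) (p alpha : R)
    (hp : 1 < p) (halpha : 0 <= alpha) :
  exists C : R, 0 < C /\
    forall (s : R) (f : heis R n -> R),
      0 < s -> s < 1 -> Cc_smooth_halfspace hn f ->
      ((C / ((s + alpha / p) * (1 - s)))%:E *
         \int[heis_measure R n]_(xi in halfspace hn)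
           (`|f xi| `^ p / x1 hn xi `^ (s * p + alpha))%:E
       <= \int[heis_measure R n]_xi \int[heis_measure R n]_xi'
            (`|f xi - f xi'| `^ p /
             (heis_norm (heis_mul (heis_inv xi) xi')
                `^ ((heis_dim n)%:R + s * p) *
              eucl_norm (xi.1 - xi'.1) `^ alpha))%:E)%E.
Proof.
have p0 : 0 < p by rewrite (lt_trans _ hp).
have N0 : 0 < 2 * n%:R + 1 :> R by rewrite ltr_wpDl// mulr_ge0.
(* The factors come from the kernel on the cone (with s replaced by 1), from the
   Hardy inequality, from the volume of the slices and from the kernel in one
   dimension. *)
pose C : R := (2 * n%:R + 1) `^ (- ((heis_dim n)%:R + p + alpha)) * (p - 1) *
  2 ^+ (2 * n) * (4^-1 `^ p / (4 * p)).
have C0 : 0 < C.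
  rewrite /C mulr_gt0 ?divr_gt0 ?powR_gt0 ?mulr_gt0 ?exprn_gt0 ?subr_gt0//.
exists C; split=> // s f s0 s1 [smf cpt supp].
have cf : continuous f by exact: (smf 0%N).
have mf := continuous_measurable_heis cf.
have f0 xi : x1 hn xi <= 0 -> f xi = 0.
  move=> x0; apply/eqP/negPn/negP => fx.
  have := supp xi (@subset_closure _ [set xi | f xi != 0] _ fx).
  by rewrite /halfspace/= ltNge x0.
have fp := Cc_Lp_fin_num p0 cf cpt.
rewrite gagliardo_translation//.
set a := _ + s * p.
have a0 : 0 <= a by rewrite addr_ge0// mulr_ge0// ltW.
pose psi (u : mheis R n * mheis R n) :=
  (cone_minorant hn p (a + alpha) f u.1 u.2)%:E.
have psi0 u : (0 <= psi u)%E by rewrite lee_fin cone_minorant_ge0.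
have mpsi : measurable_fun setT psi.
  by apply/measurable_EFinP; exact: measurable_cone_minorant.
apply: (@le_trans _ _ (\int[heis_measure R n]_eta
  \int[heis_measure R n]_xi psi (xi, eta))%E); last first.
  apply: ge0_le_subset_integral => // eta _.
  - by apply: integral_ge0 => xi _.
  - apply: integral_ge0 => xi _.
    by rewrite lee_fin mulr_ge0 ?heis_kernel_ge0 ?powR_ge0.
  - exact: integral_cone_minorant_le.
rewrite -(@fubini_tonelli _ _ _ _ R (heis_measure R n) (heis_measure R n)
  psi mpsi psi0).
have mx : measurable_fun setT (x1 hn : mheis R n -> R) by exact: measurable_x1.
have K0 : 0 <= C / ((s + alpha / p) * (1 - s)).
  apply: divr_ge0; first exact: ltW.
  by rewrite mulr_ge0 ?subr_ge0 ?(ltW s1)// addr_ge0 ?(ltW s0)// divr_ge0// ltW.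
rewrite -ge0_integralZl//; last 3 first.
- exact: measurable_ltr_set.
- apply/measurable_EFinP; apply: measurable_funTS; apply: measurable_funM.
    by apply: measurable_powR_comp; exact: measurableT_comp.
  by apply: measurable_fun_invr; exact: measurable_powR_comp.
- by move=> xi _; rewrite lee_fin divr_ge0 ?powR_ge0.
apply: ge0_le_subset_integral => // xi.
- by move=> _; rewrite mule_ge0// lee_fin// divr_ge0 ?powR_ge0.
- by move=> _; apply: integral_ge0.
move=> x0; rewrite -EFinM; exact: integral_cone_minorant_ge.
Qed.
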